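(* Let $W$ be a non-zero graphon on $(\Omega,\mu)$. For $k\ge1$, define $$D_k(W)=\sup_{\mu^k(S)>0}\frac{1}{\mu^k(S)}\int_{S\times S}W^{\otimes k}(x,y)\,d\mu^k(x)\,d\mu^k(y),$$ where the supremum is over all measurable sets $S\subseteq\Omega^k$ of positive measure. Then $$\lim_{k\to\infty}D_k(W)^{1/k}=\rho(W).$$
   Context: $(\Omega,\mu)$ is a standard atomless probability space (isomorphic to $[0,1]$ with Lebesgue measure). A graphon is a symmetric measurable function $W:\Omega^2\to[0,1]$; non-zero means not almost everywhere $0$. For $k\ge1$, $W^{\otimes k}$ is the graphon on $(\Omega^k,\mu^k)$ given by $W^{\otimes k}(x,y)=\prod_{r=1}^kW(x_r,y_r)$ for $x=(x_1,\dots,x_k)$, $y=(y_1,\dots,y_k)$. The operator $T_W$ on $L^2(\Omega)$ is $T_Wf(x)=\int_\Omega W(x,y)f(y)\,d\mu(y)$, and $\rho(W)=\|T_W\|_{2\to2}$ is its operator norm. *)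

(* Defs.v *)
From HB Require Import structures.
From mathcomp Require Import all_boot all_order all_algebra.
From mathcomp Require Import all_classical all_reals all_analysis.
From mathcomp Require Import measurable_realfun.

Set Implicit Arguments.
Unset Strict Implicit.
Unset Printing Implicit Defensive.

Import Order.TTheory GRing.Theory Num.Theory.
Import numFieldNormedType.Exports.

Local Open Scope classical_set_scope.
Local Open Scope ring_scope.

(* (T, mu) is isomorphic modulo null sets to [0, 1] with Lebesgue measure: f
   transports mu to Lebesgue measure on [0, 1] and g is its a.e. inverse.
   Preimages under g are only required to be Lebesgue measurable (a Borel set
   united with a negligible one), so that T may carry a standard Borel
   sigma-algebra as well as its completion. That g also preserves measure is a
   consequence of the other clauses. *)
Definition standard_atomless d (T : measurableType d) (R : realType)
    (mu : probability T R) : Prop :=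
  exists (f : T -> R) (g : R -> T),
    [/\ measurable_fun [set: T] f,
        forall A : set R, measurable A ->
          mu (f @^-1` A) = lebesgue_measure (A `&` `[0, 1]),
        forall B : set T, measurable B ->
          completed_algebra_gen (@lebesgue_measure R) (g @^-1` B),
        {ae mu, forall x, g (f x) = x} &
        {ae @lebesgue_measure R, forall y, y \in `[0, 1] -> f (g y) = y}].

Section power.
Context d (T : measurableType d) (R : realType).

Definition tcons k (z : T * k.-tuple T) : k.+1.-tuple T := cons_tuple z.1 z.2.

Lemma measurable_tcons k : measurable_fun [set: T * k.-tuple T] (@tcons k).
Proof. exact: measurable_cons. Qed.

HB.instance Definition _ k :=
  isMeasurableFun.Build _ _ _ _ (@tcons k) (@measurable_tcons k).

Variable mu : probability T R.

(* The k-fold product measure on T^k, by recursion on k: T^(k+1) is identified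
   with T * T^k. See power_prob_box for the characteristic property. *)
Fixpoint power_prob k : probability (k.-tuple T) R :=
  if k is k'.+1 return probability (k.-tuple T) R
  then distribution (mu \x power_prob k')%E (@tcons k')
  else dirac (nil_tuple T).

Lemma power_prob_box k (A : 'I_k -> set T) : (forall i, measurable (A i)) ->
  power_prob k [set x | forall i, A i (tnth x i)] = (\prod_(i < k) mu (A i))%E.
Proof.
elim: k A => [|k IH] A mA.
  by rewrite big_ord0 /= diracE mem_set //= => -[].
rewrite big_ord_recl -IH; last by move=> i; exact: mA.
rewrite -product_measure1E//; last first.
  rewrite (_ : mkset _ = \bigcap_(i in [set: 'I_k])
      ((@tnth k T ^~ i) @^-1` A (lift ord0 i))); last first.
    by apply/seteqP; split => x /= Ax i; [move=> _|]; exact: Ax.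
  apply: fin_bigcap_measurable => //= i _; rewrite -[X in measurable X]setTI.
  exact: measurable_tnth.
rewrite /= /distribution /pushforward; congr (product_measure1 _ _ _).
apply/seteqP; split => -[x y] /=.
  move=> Axy; split; first by have := Axy ord0.
  by move=> i; have := Axy (lift ord0 i); rewrite tnthS.
move=> [Ax Ay] i; case: (unliftP ord0 i) => [j|] ->; last by [].
by rewrite tnthS.
Qed.

End power.

Definition graphon d (T : measurableType d) (R : realType) (W : T * T -> R) :
    Prop :=
  [/\ measurable_fun [set: T * T] W,
      forall x y, W (x, y) = W (y, x) &
      forall z, 0 <= W z <= 1].

Section graphon_operations.
Context d (T : measurableType d) (R : realType).

Definition tensor_power (W : T * T -> R) k (z : k.-tuple T * k.-tuple T) : R :=
  \prod_(r < k) W (tnth z.1 r, tnth z.2 r).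

Lemma graphon_tensor_power (W : T * T -> R) k :
  graphon W -> graphon (@tensor_power W k).
Proof.
move=> [mW sW W01]; split.
- apply: measurable_prod => r _.
  apply: (measurableT_comp mW) => /=.
  apply/measurable_fun_pair => /=.
    exact: (measurableT_comp (@measurable_tnth _ T _ r)).
  exact: (measurableT_comp (@measurable_tnth _ T _ r)).
- by move=> x y; apply: eq_bigr => r _; exact: sW.
- move=> z; have Wz r := W01 (tnth z.1 r, tnth z.2 r).
  rewrite prodr_ge0 ?prodr_ile1//= => r _; by have /andP[] := Wz r.
Qed.

Variable mu : probability T R.

Definition kernel_op (W : T * T -> R) (f : T -> R) (x : T) : R :=
  \int[mu]_y (W (x, y) * f y).

(* Operator norm of A on (real) L^2(mu), for A well defined modulo a.e.
   equality. *)
Definition L2_opnorm (A : (T -> R) -> (T -> R)) : \bar R :=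
  ereal_sup [set 'N[mu]_2%:E[EFin \o A f]%E | f in
    [set f | f \in Lfun mu 2%:E /\ ('N[mu]_2%:E[EFin \o f] <= 1)%E]].

Definition rho (W : T * T -> R) : \bar R := L2_opnorm (kernel_op W).

Definition max_density (W : T * T -> R) k : \bar R :=
  let muk := power_prob mu k in
  ereal_sup
    [set ((muk S)^-1 *
          \int[muk \x muk]_(z in S `*` S) (tensor_power W z)%:E)%E | S in
      [set S | measurable S /\ (0 < muk S)%E]].

End graphon_operations.

(* Main.v *)
Require Import Defs.
From mathcomp Require Import all_boot all_order all_algebra.
From mathcomp Require Import all_classical all_reals all_analysis.
From mathcomp Require Import measurable_realfun ring lra.

Set Implicit Arguments.
Unset Strict Implicit.
Unset Printing Implicit Defensive.

Import Order.TTheory GRing.Theory Num.Theory.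
Import numFieldNormedType.Exports.

Local Open Scope classical_set_scope.
Local Open Scope ring_scope.

(** Upper bound: [rho] is multiplicative under tensor powers.  Peeling off one
    coordinate at a time, Cauchy-Schwarz on the slices turns a bound for
    [W^(k)] and the bound [rho] for [W] into a bound for [W^(k+1)]
    ([tensor_form_le_rho]); applied to indicators it gives
    [max_density W k <= rho ^ k].

    Lower bound: since [W] is symmetric and nonnegative, [rho] is the supremum
    of [<g, W g> / |g|^2] over nonnegative [g], and one may restrict to [g]
    that vanish or lie between two positive constants
    ([lt_rho_bounded_away]).  Take such a [g] with [<g, W g> > r |g|^2].  The
    product function [F x = g x_1 ... g x_k] has
    [<F, W^(k) F> = <g, W g>^k] and [|F|^2 = |g|^(2k)], so it would do as a
    test function, but an indicator is wanted.  Under the probability law on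
    pairs with density proportional to [F(x) W^(k)(x, y) F(y)], the pairs
    [(x_i, y_i)] are independent and both marginals are the same, so
    [log F(x)] and [log F(y)] both concentrate, at scale [o(k)], around the
    same value.  Scaling [g] makes that value [0]
    ([exists_tilted_function]).  Hence, up to an exponentially small error
    controlled by a Chernoff bound ([tensor_power_weight_le],
    [weighted_mgf_le]), all of [<F, W^(k) F>] comes from pairs with both
    points in the set [S] where [exp (- eps k) <= F <= exp (eps k)].  On [S]
    the function [F] is an indicator up to a factor [exp (eps k)], so the
    density of [S] is at least about [exp (- 4 eps k) r^k]
    ([max_density_ge]); now let [eps] tend to [0] and [r] to [rho].

    The symmetry of [W] matters here: for the star-shaped kernels a single
    level set of an optimal [g] is far from optimal, and only the balance of
    the two marginals in a high power makes one level set sufficient. *)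

(** * Integration against power measures *)

Section power_integral.
Context d (T : measurableType d) (R : realType) (mu : probability T R).
Local Open Scope ereal_scope.

Lemma ge0_integral_power_probS k (f : k.+1.-tuple T -> \bar R) :
    measurable_fun [set: k.+1.-tuple T] f -> (forall x, 0 <= f x) ->
  \int[power_prob mu k.+1]_x f x =
  \int[mu]_x0 \int[power_prob mu k]_x f (tcons (x0, x)).
Proof.
move=> mf f0; rewrite /= ge0_integral_distribution// fubini_tonelli1//.
  exact: measurableT_comp.
by move=> x; exact: f0.
Qed.

Lemma measurable_tcons_pair k :
  measurable_fun [set: (T * T) * (k.-tuple T * k.-tuple T)]
    (fun z => (tcons (z.1.1, z.2.1), tcons (z.1.2, z.2.2))).
Proof.
apply/measurable_fun_pair => /=; apply: measurable_cons.
- exact: (measurableT_comp (@measurable_fst _ _ T T)).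
- exact: (measurableT_comp (@measurable_fst _ _ (k.-tuple T) (k.-tuple T))).
- exact: (measurableT_comp (@measurable_snd _ _ T T)).
- exact: (measurableT_comp (@measurable_snd _ _ (k.-tuple T) (k.-tuple T))).
Qed.

(** Regrouping a pair of (k+1)-tuples as a pair of heads and a pair of tails:
    this is the inductive step behind every computation on tensor powers. *)
Lemma ge0_integral_power_prob2S k
    (f : k.+1.-tuple T * k.+1.-tuple T -> \bar R) :
    measurable_fun [set: k.+1.-tuple T * k.+1.-tuple T] f ->
    (forall x, 0 <= f x) ->
  \int[power_prob mu k.+1 \x power_prob mu k.+1]_z f z =
  \int[mu \x mu]_p \int[power_prob mu k \x power_prob mu k]_q
     f (tcons (p.1, q.1), tcons (p.2, q.2)).
Proof.
move=> mf f0.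
have mF := measurableT_comp mf (@measurable_tcons_pair k).
have mFp p : measurable_fun setT
    (fun q => f (tcons (p.1, q.1), tcons (p.2, q.2))).
  by have := measurableT_comp mF (measurable_pair1 p).
have mfubini x0 : measurable_fun setT (fun z : k.-tuple T * T =>
    \int[power_prob mu k]_y f (tcons (x0, z.1), tcons (z.2, y))).
  apply: (@measurable_fun_fubini_tonelli_F _ _ _ _ _ (power_prob mu k)
    (fun w : (k.-tuple T * T) * k.-tuple T =>
      f (tcons (x0, w.1.1), tcons (w.1.2, w.2)))) => //.
  apply: (measurableT_comp mf); apply/measurable_fun_pair => /=;
    apply: measurable_cons => //.
    exact: (measurableT_comp (@measurable_fst _ _ (k.-tuple T) T)).
    exact: (measurableT_comp (@measurable_snd _ _ (k.-tuple T) T)).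
  exact: measurable_snd.
rewrite [LHS]fubini_tonelli1// ge0_integral_power_probS//; last 2 first.
- exact: measurable_fun_fubini_tonelli_F.
- by move=> x; apply: integral_ge0.
rewrite [RHS]fubini_tonelli1//; last 2 first.
- have := @measurable_fun_fubini_tonelli_F _ _ _ _ _
    ((power_prob mu k \x power_prob mu k) : probability _ R) _ mF; apply.
  by move=> z; exact: f0.
- by move=> p; apply: integral_ge0.
apply: eq_integral => x0 _; rewrite /fubini_F.
transitivity (\int[power_prob mu k]_x \int[mu]_y0 \int[power_prob mu k]_y
    f (tcons (x0, x), tcons (y0, y))).
  apply: eq_integral => x _; rewrite ge0_integral_power_probS//.
  by apply: (measurableT_comp mf); exact: measurable_pair1.
rewrite (@fubini_tonelli _ _ _ _ _ (power_prob mu k) mu (fun z =>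
    \int[power_prob mu k]_y f (tcons (x0, z.1), tcons (z.2, y))))//; last first.
  by move=> z; apply: integral_ge0.
apply: eq_integral => y0 _; rewrite fubini_tonelli1//.
Qed.

End power_integral.

Section tensor_power.
Context d (T : measurableType d) (R : realType).

Lemma measurable_tensor_power (G : T * T -> R) k :
    measurable_fun [set: T * T] G ->
  measurable_fun [set: k.-tuple T * k.-tuple T] (@tensor_power _ T R G k).
Proof.
move=> mG; apply: measurable_prod => r _; apply: (measurableT_comp mG) => /=.
by apply/measurable_fun_pair => /=;
  exact: (measurableT_comp (@measurable_tnth _ T _ r)).
Qed.

Lemma tensor_power_ge0 (G : T * T -> R) k z :
  (forall p, 0 <= G p) -> 0 <= @tensor_power _ T R G k z.
Proof. by move=> G0; apply: prodr_ge0. Qed.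

Lemma tensor_powerS (G : T * T -> R) k (p : T * T)
    (q : k.-tuple T * k.-tuple T) :
  tensor_power G (tcons (p.1, q.1), tcons (p.2, q.2)) =
  G p * tensor_power G q.
Proof.
rewrite /tensor_power big_ord_recl/=; congr (G _ * _).
  by case: p.
by apply: eq_bigr => i _; rewrite !tnthS.
Qed.

Variable mu : probability T R.
Local Open Scope ereal_scope.

Lemma ge0_integral_tensor_power (G : T * T -> R) k :
    measurable_fun [set: T * T] G -> (forall p, 0 <= G p)%R ->
  \int[power_prob mu k \x power_prob mu k]_z (tensor_power G z)%:E =
  (\int[mu \x mu]_p (G p)%:E) ^+ k.
Proof.
move=> mG G0; elim: k => [|k IH].
  rewrite expe0 (eq_integral (cst 1)); last first.
    by move=> z _; rewrite /tensor_power big_ord0.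
  by rewrite integral_cst// mul1e; exact: probability_setT.
rewrite ge0_integral_power_prob2S//; last 2 first.
- by apply/measurable_EFinP; exact: measurable_tensor_power.
- by move=> z; rewrite lee_fin tensor_power_ge0.
transitivity (\int[mu \x mu]_p ((G p)%:E * (\int[mu \x mu]_p (G p)%:E) ^+ k)).
  apply: eq_integral => p _; rewrite -IH.
  rewrite -ge0_integralZl_EFin//.
  - by apply: eq_integral => q _; rewrite tensor_powerS EFinM.
  - by move=> q _; rewrite lee_fin tensor_power_ge0.
  - by apply/measurable_EFinP; exact: measurable_tensor_power.
rewrite ge0_integralZr//.
- by rewrite expeS muleC.
- exact/measurable_EFinP.
- by move=> p _; rewrite lee_fin.
- by apply: expe_ge0; apply: integral_ge0 => p _; rewrite lee_fin.
Qed.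

End tensor_power.

(** * The upper bound: the norm is multiplicative under tensor powers *)

Section norm2.
Context d (X : measurableType d) (R : realType) (P : probability X R).
Local Open Scope ereal_scope.

Lemma integral_prob_cst (c : \bar R) : \int[P]_(_ in setT) c = c.
Proof.
by rewrite integral_cst// -[RHS]mule1; congr (_ * _); exact: probability_setT.
Qed.

Lemma norm2E (f : X -> R) :
  'N[P]_2%:E[EFin \o f] = (\int[P]_x (f x ^+ 2)%:E) `^ 2^-1.
Proof.
rewrite unlock; congr (_ `^ _); apply: eq_integral => x _.
by rewrite /= powR_mulrn// -normrX ger0_norm// sqr_ge0.
Qed.

Lemma norm2_sqr (f : X -> R) :
  'N[P]_2%:E[EFin \o f] `^ 2 = \int[P]_x (f x ^+ 2)%:E.
Proof.
rewrite norm2E -poweRrM mulVf// poweRe1//.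
by apply: integral_ge0 => x _; rewrite lee_fin sqr_ge0.
Qed.

Lemma norm2Z (c : R) (f : X -> R) : measurable_fun setT f -> (0 <= c)%R ->
  'N[P]_2%:E[EFin \o (fun x => c * f x)%R] = c%:E * 'N[P]_2%:E[EFin \o f].
Proof.
move=> mf c0; rewrite !norm2E.
under eq_integral do rewrite exprMn EFinM.
rewrite ge0_integralZl_EFin ?sqr_ge0//; last 2 first.
- by move=> x _; rewrite lee_fin sqr_ge0.
- by apply/measurable_EFinP; exact: measurable_funX.
rewrite poweRM ?lee_fin ?sqr_ge0//; last first.
  by apply: integral_ge0 => x _; rewrite lee_fin sqr_ge0.
by rewrite poweR_EFin powR12_sqrt ?sqr_ge0// sqrtr_sqr ger0_norm.
Qed.

Lemma norm2_le1 (f : X -> R) : measurable_fun setT f ->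
  (forall x, 0 <= f x <= 1)%R -> 'N[P]_2%:E[EFin \o f] <= 1.
Proof.
move=> mf f01; rewrite norm2E -(@poweR1r _ 2^-1).
have f2 : 0 <= \int[P]_x (f x ^+ 2)%:E.
  by apply: integral_ge0 => x _; rewrite lee_fin sqr_ge0.
apply: gt0_ler_poweR => //; [by rewrite in_itv/= f2 leey| |].
  by rewrite in_itv/= leey lee_fin ler01.
rewrite -[leRHS]integral_prob_cst.
apply: ge0_le_integral => // [x _||x _].
- by rewrite lee_fin sqr_ge0.
- by apply/measurable_EFinP; exact: measurable_funX.
- by have /andP[? ?] := f01 x; rewrite lee_fin exprn_ile1.
Qed.

Lemma bounded_integrable (f : X -> R) (M : R) : measurable_fun setT f ->
  (forall x, `|f x| <= M)%R -> P.-integrable setT (EFin \o f).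
Proof.
move=> mf fM; apply: measurable_bounded_integrable => //.
  by rewrite (le_lt_trans (probability_le1 P measurableT))// ltry.
exists M; split; first by rewrite num_real.
by move=> y My x _; exact: (le_trans (fM x) (ltW My)).
Qed.

End norm2.

Section kernel_operator.
Context d (T : measurableType d) (R : realType) (mu : probability T R).
Variable (W : T * T -> R).
Hypothesis hW : graphon W.
Local Open Scope ereal_scope.

Let mW : measurable_fun setT W. Proof. by case: hW. Qed.
Let W0 z : (0 <= W z)%R. Proof. by case: hW => _ _ /(_ z)/andP[]. Qed.
Let W1 z : (W z <= 1)%R. Proof. by case: hW => _ _ /(_ z)/andP[]. Qed.
Let mWx x : measurable_fun setT (fun y => W (x, y)).
Proof. exact: measurableT_comp. Qed.

Lemma integrable_kernel (f : T -> R) x : mu.-integrable setT (EFin \o f) ->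
  mu.-integrable setT (fun y => (W (x, y) * f y)%:E).
Proof.
move=> intf; move: (intf); apply: le_integrable => //.
  apply/measurable_EFinP/measurable_funM => //.
  by apply/measurable_EFinP; exact: measurable_int intf.
by move=> y _; rewrite /= lee_fin normrM ger0_norm// ler_piMl.
Qed.

Lemma kernel_opE (f : T -> R) x : mu.-integrable setT (EFin \o f) ->
  (kernel_op mu W f x)%:E = \int[mu]_y (W (x, y) * f y)%:E.
Proof.
move=> intf; rewrite /kernel_op /Rintegral fineK//.
by apply: integrable_fin_num => //; exact: integrable_kernel.
Qed.

Lemma measurable_kernel_op (f : T -> R) : mu.-integrable setT (EFin \o f) ->
  measurable_fun setT (kernel_op mu W f).
Proof.
move=> intf; have mf : measurable_fun setT f.
  by apply/measurable_EFinP; exact: measurable_int intf.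
have mg : measurable_fun setT (fun z : T * T => (W z * f z.2)%:E).
  apply/measurable_EFinP/measurable_funM => //.
  exact: (measurableT_comp mf).
apply/measurable_EFinP; rewrite (_ : EFin \o _ =
    fubini_F mu (fun z : T * T => (W z * f z.2)%:E)); last first.
  by apply/funext => x /=; rewrite kernel_opE.
apply: measurable_fubini_F; apply/integrable12ltyP => //.
apply: (@le_lt_trans _ _ (\int[mu]_x \int[mu]_y `|(f y)%:E|)).
  apply: ge0_le_integral => //.
  - by move=> x _; apply: integral_ge0.
  - apply: (@measurable_fun_fubini_tonelli_F _ _ _ _ _ mu
      (fun z => `|(W z * f z.2)%:E|)) => //.
    exact: measurableT_comp.
  - move=> x _; apply: ge0_le_integral => //.
    + apply: measurableT_comp => //.
      by apply: (measurable_int mu); exact: integrable_kernel.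
    + by apply: measurableT_comp => //; exact/measurable_EFinP.
    + by move=> y _; rewrite lee_fin normrM ger0_norm// ler_piMl.
by rewrite integral_prob_cst; case/integrableP : intf.
Qed.

Lemma kernel_op01 (f : T -> R) x : measurable_fun setT f ->
  (forall y, 0 <= f y <= 1)%R -> (0 <= kernel_op mu W f x <= 1)%R.
Proof.
move=> mf f01; have intf : mu.-integrable setT (EFin \o f).
  apply: (@bounded_integrable _ _ _ _ _ 1) => // y.
  by have /andP[? ?] := f01 y; rewrite ger0_norm.
rewrite -!lee_fin kernel_opE// integral_ge0/=; last first.
  by move=> y _; rewrite lee_fin mulr_ge0//; have /andP[] := f01 y.
rewrite -[leRHS](integral_prob_cst mu).
apply: ge0_le_integral => // [y _||y _].
- by rewrite lee_fin mulr_ge0//; have /andP[] := f01 y.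
- by apply/measurable_EFinP; exact: measurable_funM.
- by have /andP[? ?] := f01 y; rewrite lee_fin mulr_ile1.
Qed.

(** [rho] only speaks of the unit ball, so [f] is rescaled to norm 1; when [f]
    is null, so is its image. *)
Lemma norm2_kernel_op_le_rho (f : T -> R) : measurable_fun setT f ->
    (forall x, 0 <= f x <= 1)%R ->
  'N[mu]_2%:E[EFin \o kernel_op mu W f] <=
  rho mu W * 'N[mu]_2%:E[EFin \o f].
Proof.
move=> mf f01; have intf : mu.-integrable setT (EFin \o f).
  apply: (@bounded_integrable _ _ _ _ _ 1) => // y.
  by have /andP[? ?] := f01 y; rewrite ger0_norm.
have Nf1 := norm2_le1 mu mf f01.
have Nf_fin : 'N[mu]_2%:E[EFin \o f] \is a fin_num.
  by rewrite ge0_fin_numE ?Lnorm_ge0// (le_lt_trans Nf1)// ltry.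
have [Nf0|Nf0] := eqVneq 'N[mu]_2%:E[EFin \o f] 0.
  rewrite Nf0 mule0 (@eq_Lnorm _ _ _ _ _ _ (cst 0)) ?Lnorm0//.
  move=> x /=; rewrite kernel_opE// -(integral0 mu setT).
  apply: ae_eq_integral => //.
    by apply/measurable_EFinP; exact: measurable_funM.
  have mEf : measurable_fun setT (EFin \o f) by exact/measurable_EFinP.
  have := Lnorm_eq0_eq0 mEf _ Nf0; rewrite lte_fin => /(_ (ltr0n _ 2)).
  by apply: filterS => y /(_ I)/= [->] _; rewrite mulr0.
pose c := fine 'N[mu]_2%:E[EFin \o f].
have c0 : (0 < c)%R.
  by rewrite fine_gt0// lt0e Nf0 Lnorm_ge0 -ge0_fin_numE ?Lnorm_ge0.
have cE : 'N[mu]_2%:E[EFin \o f] = c%:E by rewrite fineK.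
pose g y := (c^-1 * f y)%R.
have mg : measurable_fun setT g by exact: measurable_funM.
have intg : mu.-integrable setT (EFin \o g).
  exact: (integrableZl measurableT c^-1 intf).
have Ng : 'N[mu]_2%:E[EFin \o g] = 1.
  by rewrite norm2Z ?invr_ge0 1?ltW// cE -EFinM mulVf ?gt_eqF.
have -> : kernel_op mu W f = (fun x => c * kernel_op mu W g x)%R.
  apply/funext => x; apply: EFin_inj.
  rewrite EFinM !kernel_opE//.
  rewrite -integralZl//; last exact: integrable_kernel.
  apply: eq_integral => y _; rewrite -EFinM; congr EFin.
  by rewrite /g [in RHS]mulrCA mulVKf// gt_eqF.
rewrite (norm2Z _ _ (ltW c0)); last exact: measurable_kernel_op.
rewrite cE muleC lee_pmul2r ?lte_fin//.
apply: ereal_sup_ubound; exists g => //; split; last by rewrite Ng.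
rewrite inE; apply/andP; split; rewrite inE//=.
by rewrite /finite_norm Ng ltry.
Qed.

Lemma kernel_form_le_rho (f g : T -> R) :
    measurable_fun setT f -> (forall x, 0 <= f x <= 1)%R ->
    measurable_fun setT g -> (forall x, 0 <= g x <= 1)%R ->
  \int[mu \x mu]_z (f z.1 * W z * g z.2)%:E <=
  rho mu W * ('N[mu]_2%:E[EFin \o f] * 'N[mu]_2%:E[EFin \o g]).
Proof.
move=> mf f01 mg g01.
have f0 x : (0 <= f x)%R by case/andP: (f01 x).
have g0 x : (0 <= g x)%R by case/andP: (g01 x).
have intg : mu.-integrable setT (EFin \o g).
  apply: (@bounded_integrable _ _ _ _ _ 1) => // y.
  by have /andP[? ?] := g01 y; rewrite ger0_norm.
rewrite fubini_tonelli1//; last 2 first.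
- apply/measurable_EFinP/measurable_funM; last exact: (measurableT_comp mg).
  by apply: measurable_funM => //; exact: (measurableT_comp mf).
- by move=> z; rewrite lee_fin !mulr_ge0.
rewrite [leLHS](_ : _ =
    'N[mu]_1[EFin \o (f \* kernel_op mu W g)%R]); last first.
  rewrite Lnorm1; apply: eq_integral => x _; rewrite /fubini_F/=.
  have /andP[Tg0 _] := kernel_op01 x mg g01.
  rewrite ger0_norm ?mulr_ge0// EFinM kernel_opE// -ge0_integralZl_EFin//.
  - by apply: eq_integral => y _; rewrite -EFinM mulrA.
  - by move=> y _; rewrite lee_fin mulr_ge0.
  - by apply/measurable_EFinP; exact: measurable_funM.
have := @hoelder _ _ _ mu f (kernel_op mu W g) 2 2 mf
  (measurable_kernel_op intg).
move=> /(_ (ltr0n _ 2) (ltr0n _ 2)); rewrite -mulr2n -[(_ *+ 2)%R]mulr_natr.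
rewrite mulVf// => /(_ erefl) /le_trans; apply.
by rewrite muleCA lee_wpmul2l ?Lnorm_ge0// norm2_kernel_op_le_rho.
Qed.

End kernel_operator.

Lemma integral_setX_indic d (X : measurableType d) (R : realType)
    (P : probability X R) (S : set X) (K : X * X -> R) :
  (\int[P \x P]_(z in S `*` S) (K z)%:E =
   \int[P \x P]_z (\1_S z.1 * K z * \1_S z.2)%:E)%E.
Proof.
rewrite integral_mkcond; apply: eq_integral => -[x y] _.
rewrite patchE in_setX !indicE/=.
by case: (x \in S); case: (y \in S); rewrite ?mul1r ?mul0r ?mulr1 ?mulr0.
Qed.

Section upper_bound.
Context d (T : measurableType d) (R : realType) (mu : probability T R).
Local Open Scope ereal_scope.

(** The L2 norm of [f] along the last [k] coordinates; it collapses a bilinear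
    form on k+1 coordinates to one on the first coordinate. *)
Definition slice_norm k (f : k.+1.-tuple T -> R) (x0 : T) : R :=
  fine 'N[power_prob mu k]_2%:E[EFin \o (fun x => f (tcons (x0, x)))].

Section slice_norm.
Variables (k : nat) (f : k.+1.-tuple T -> R).
Hypothesis mf : measurable_fun setT f.
Hypothesis f01 : forall x, (0 <= f x <= 1)%R.

Let mfx x0 : measurable_fun setT (fun x => f (tcons (x0, x))).
Proof.
by have := measurableT_comp (measurableT_comp mf (@measurable_tcons _ T k))
  (measurable_pair1 x0).
Qed.

Let norm_le1 x0 :
  'N[power_prob mu k]_2%:E[EFin \o (fun x => f (tcons (x0, x)))] <= 1.
Proof. exact: norm2_le1. Qed.

Lemma slice_normE x0 : (slice_norm f x0)%:E =
  'N[power_prob mu k]_2%:E[EFin \o (fun x => f (tcons (x0, x)))].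
Proof.
by rewrite fineK// ge0_fin_numE ?Lnorm_ge0// (le_lt_trans (norm_le1 _)) ?ltry.
Qed.

Lemma slice_norm01 x0 : (0 <= slice_norm f x0 <= 1)%R.
Proof. by rewrite -!lee_fin slice_normE Lnorm_ge0 norm_le1. Qed.

Lemma measurable_slice_norm : measurable_fun setT (slice_norm f).
Proof.
rewrite (_ : slice_norm f = (fun x0 => fine
    (\int[power_prob mu k]_x (f (tcons (x0, x)) ^+ 2)%:E) `^ 2^-1)%R).
  apply: (measurableT_comp (measurable_powR _)).
  apply: measurableT_comp => //.
  apply: (@measurable_fun_fubini_tonelli_F _ _ _ _ _ (power_prob mu k)
    (fun z => (f (tcons z) ^+ 2)%:E)); last first.
    by move=> z; rewrite lee_fin sqr_ge0.
  apply/measurable_EFinP/measurable_funX.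
  exact: (measurableT_comp mf (@measurable_tcons _ T k)).
by apply/funext => x0; rewrite /slice_norm norm2E fine_poweR.
Qed.

Lemma norm2_slice_norm : 'N[mu]_2%:E[EFin \o slice_norm f] =
  'N[power_prob mu k.+1]_2%:E[EFin \o f].
Proof.
rewrite !norm2E; congr (_ `^ _).
rewrite ge0_integral_power_probS; last 2 first.
- by apply/measurable_EFinP; exact: measurable_funX.
- by move=> z; rewrite lee_fin sqr_ge0.
apply: eq_integral => x0 _; rewrite -norm2_sqr -slice_normE.
by rewrite poweR_EFin powR_mulrn//; have /andP[] := slice_norm01 x0.
Qed.

End slice_norm.

Variable W : T * T -> R.
Hypothesis hW : graphon W.
Let mW : measurable_fun setT W. Proof. by case: hW. Qed.
Let W0 z : (0 <= W z)%R. Proof. by case: hW => _ _ /(_ z)/andP[]. Qed.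

Lemma rho_ge0 : 0 <= rho mu W.
Proof.
apply: ereal_sup_ubound; exists (cst 0%R).
  split; last by rewrite (@eq_Lnorm _ _ _ _ _ _ (cst 0)) ?Lnorm0.
  exact: Lfun_cst.
rewrite (@eq_Lnorm _ _ _ _ _ _ (cst 0)) ?Lnorm0// => x /=.
rewrite /kernel_op /Rintegral integral0_eq// => y _.
by rewrite /= mulr0.
Qed.

(** Multiplicativity of the norm.  For fixed first coordinates the inner form
    is at most [rho ^ k] times the product of the slice norms, and the slice
    norms are functions of one variable to which the bound for [W] applies. *)
Lemma tensor_form_le_rho k (f g : k.-tuple T -> R) :
    measurable_fun setT f -> (forall x, 0 <= f x <= 1)%R ->
    measurable_fun setT g -> (forall x, 0 <= g x <= 1)%R ->
  \int[power_prob mu k \x power_prob mu k]_z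
    (f z.1 * tensor_power W z * g z.2)%:E <=
  rho mu W ^+ k * ('N[power_prob mu k]_2%:E[EFin \o f] *
                   'N[power_prob mu k]_2%:E[EFin \o g]).
Proof.
elim: k f g => [|k IH] f g mf f01 mg g01.
  have fE x : f x = f [tuple] by rewrite (tuple0 x).
  have gE x : g x = g [tuple] by rewrite (tuple0 x).
  rewrite expe0 mul1e !norm2E.
  rewrite (eq_integral (cst (f [tuple] * g [tuple])%:E)); last first.
    by move=> z _; rewrite fE gE /tensor_power big_ord0 mulr1.
  under [X in _ <= X `^ _ * _]eq_integral do rewrite fE.
  under [X in _ <= _ * X `^ _]eq_integral do rewrite gE.
  rewrite !integral_prob_cst !poweR_EFin !powR12_sqrt ?sqr_ge0//.
  have /andP[f0 _] := f01 [tuple]; have /andP[g0 _] := g01 [tuple].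
  by rewrite !sqrtr_sqr !ger0_norm.
have f0 x : (0 <= f x)%R by case/andP: (f01 x).
have g0 x : (0 <= g x)%R by case/andP: (g01 x).
have mz : measurable_fun setT
    (fun z => (f z.1 * tensor_power W z * g z.2)%:E).
  apply/measurable_EFinP/measurable_funM; last exact: (measurableT_comp mg).
  apply: measurable_funM; first exact: (measurableT_comp mf).
  exact: measurable_tensor_power.
rewrite ge0_integral_power_prob2S//; last first.
  by move=> z; rewrite lee_fin !mulr_ge0// tensor_power_ge0.
pose F := slice_norm f; pose G := slice_norm g.
have F0 x : (0 <= F x)%R by case/andP: (slice_norm01 mf f01 x).
have G0 x : (0 <= G x)%R by case/andP: (slice_norm01 mg g01 x).
have mFWG : measurable_fun setT (fun p => (F p.1 * W p * G p.2)%:E).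
  apply/measurable_EFinP/measurable_funM; last first.
    exact: (measurableT_comp (measurable_slice_norm mg)).
  apply: measurable_funM => //.
  exact: (measurableT_comp (measurable_slice_norm mf)).
have rhok0 : 0 <= rho mu W ^+ k by apply: expe_ge0; exact: rho_ge0.
apply: (@le_trans _ _
    (\int[mu \x mu]_p (rho mu W ^+ k * (F p.1 * W p * G p.2)%:E))).
  apply: ge0_le_integral => //.
  - move=> p _; apply: integral_ge0 => q _.
    by rewrite lee_fin !mulr_ge0// tensor_power_ge0.
  - have := @measurable_fun_fubini_tonelli_F _ _ _ _ _
      ((power_prob mu k \x power_prob mu k) : probability _ R) _
      (measurableT_comp mz (@measurable_tcons_pair _ T k)); apply.
    by move=> z; rewrite lee_fin !mulr_ge0// tensor_power_ge0.
  - exact: emeasurable_funM.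
  move=> [x0 y0] _ /=.
  have mfx : measurable_fun setT (fun x => f (tcons (x0, x))).
    by have := measurableT_comp (measurableT_comp mf (@measurable_tcons _ T k))
      (measurable_pair1 x0).
  have mgy : measurable_fun setT (fun y => g (tcons (y0, y))).
    by have := measurableT_comp (measurableT_comp mg (@measurable_tcons _ T k))
      (measurable_pair1 y0).
  rewrite [leLHS](_ : _ = (W (x0, y0))%:E *
    \int[power_prob mu k \x power_prob mu k]_q
      (f (tcons (x0, q.1)) * tensor_power W q * g (tcons (y0, q.2)))%:E).
    rewrite [leRHS](_ : _ = (W (x0, y0))%:E *
        (rho mu W ^+ k * ((F x0)%:E * (G y0)%:E))); last first.
      by rewrite [RHS]muleCA -!EFinM; congr (_ * _%:E); ring.
    by rewrite !slice_normE// lee_wpmul2l ?lee_fin//; exact: IH.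
  rewrite -ge0_integralZl_EFin//.
  - apply: eq_integral => q _; rewrite (tensor_powerS W (x0, y0) q) -EFinM.
    by congr EFin; ring.
  - by move=> q _; rewrite lee_fin !mulr_ge0// tensor_power_ge0.
  - apply/measurable_EFinP/measurable_funM; last exact: (measurableT_comp mgy).
    apply: measurable_funM; first exact: (measurableT_comp mfx).
    exact: measurable_tensor_power.
rewrite ge0_integralZl//; last by move=> p _; rewrite lee_fin !mulr_ge0.
rewrite -!norm2_slice_norm// expeS [rho mu W * _]muleC -muleA lee_wpmul2l//.
apply: kernel_form_le_rho => //; first exact: measurable_slice_norm.
- exact: slice_norm01.
- exact: measurable_slice_norm.
- exact: slice_norm01.
Qed.

Lemma max_density_le_rho k : max_density mu W k <= rho mu W ^+ k.
Proof.
apply: ub_ereal_sup => _ [S [mS S0] <-] /=.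
have muS : power_prob mu k S \is a fin_num by exact: fin_num_measure.
have mI : measurable_fun setT (\1_S : _ -> R) by exact: measurable_indic.
have I01 x : (0 <= (\1_S : _ -> R) x <= 1)%R.
  by rewrite indicE; case: (x \in S); rewrite /= ?lexx ler01.
have NI : \int[power_prob mu k]_x ((\1_S x : R) ^+ 2)%:E = power_prob mu k S.
  rewrite (eq_integral (EFin \o \1_S)) ?integral_indic ?setIT// => x _ /=.
  by rewrite indicE; case: (x \in S); rewrite ?expr1n ?expr0n.
have := tensor_form_le_rho mI I01 mI I01; rewrite norm2E/= NI.
move: S0 NI; rewrite -(fineK muS); set c := fine _ => c0 _.
rewrite inver gt_eqF// lee_pdivrMl// muleC.
have c0' : (0 <= c)%R by rewrite -lee_fin ltW.
rewrite poweR_EFin powR12_sqrt// -EFinM -expr2 sqr_sqrtr//.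
by rewrite integral_setX_indic.
Qed.

End upper_bound.

(** * The norm as a supremum of nonnegative quadratic forms *)

Section ge0_EFin_integral.
Context d (X : measurableType d) (R : realType)
  (P : {measure set X -> \bar R}).
Local Open Scope ereal_scope.

Lemma ge0_integralD_EFin (f g : X -> R) :
    measurable_fun setT f -> (forall x, 0 <= f x)%R ->
    measurable_fun setT g -> (forall x, 0 <= g x)%R ->
  \int[P]_x (f x + g x)%:E = \int[P]_x (f x)%:E + \int[P]_x (g x)%:E.
Proof.
move=> mf f0 mg g0; under eq_integral do rewrite EFinD.
by rewrite ge0_integralD//;
  [move=> x _; rewrite lee_fin|exact/measurable_EFinP|
   move=> x _; rewrite lee_fin|exact/measurable_EFinP].
Qed.

Lemma ge0_integralM_EFin (c : R) (f : X -> R) :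
    measurable_fun setT f -> (forall x, 0 <= f x)%R -> (0 <= c)%R ->
  \int[P]_x (c * f x)%:E = c%:E * \int[P]_x (f x)%:E.
Proof.
move=> mf f0 c0; under eq_integral do rewrite EFinM.
by rewrite ge0_integralZl_EFin//;
  [move=> x _; rewrite lee_fin|exact/measurable_EFinP].
Qed.

Lemma ge0_le_integral_EFin (f g : X -> R) :
    measurable_fun setT f -> (forall x, 0 <= f x)%R ->
    measurable_fun setT g -> (forall x, f x <= g x)%R ->
  \int[P]_x (f x)%:E <= \int[P]_x (g x)%:E.
Proof.
move=> mf f0 mg fg; apply: ge0_le_integral => //.
- by move=> x _; rewrite lee_fin.
- exact/measurable_EFinP.
- exact/measurable_EFinP.
- by move=> x _; rewrite lee_fin.
Qed.

Lemma ge0_integralD4_le (a1 a2 a3 a4 : X -> R) (c : R) :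
    measurable_fun setT a1 -> measurable_fun setT a2 ->
    measurable_fun setT a3 -> measurable_fun setT a4 ->
    (forall x, 0 <= a1 x)%R -> (forall x, 0 <= a2 x)%R ->
    (forall x, 0 <= a3 x)%R -> (forall x, 0 <= a4 x)%R ->
    \int[P]_x (a1 x)%:E <= c%:E -> \int[P]_x (a2 x)%:E <= c%:E ->
    \int[P]_x (a3 x)%:E <= c%:E -> \int[P]_x (a4 x)%:E <= c%:E ->
  \int[P]_x (a1 x + a2 x + (a3 x + a4 x))%:E <= (c + c + (c + c))%:E.
Proof.
move=> m1 m2 m3 m4 p1 p2 p3 p4 h1 h2 h3 h4.
rewrite ge0_integralD_EFin; last 4 first.
- exact: measurable_funD.
- by move=> x; rewrite addr_ge0.
- exact: measurable_funD.
- by move=> x; rewrite addr_ge0.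
rewrite (ge0_integralD_EFin m1 p1 m2 p2) (ge0_integralD_EFin m3 p3 m4 p4).
by rewrite !EFinD !leeD.
Qed.

End ge0_EFin_integral.

Lemma ge0_integral_swap d (X : measurableType d) (R : realType)
    (P : probability X R) (F : X * X -> \bar R) :
    measurable_fun setT F -> (forall z, 0 <= F z)%E ->
  (\int[P \x P]_z F z = \int[P \x P]_z F (z.2, z.1))%E.
Proof.
move=> mF F0.
rewrite [LHS]fubini_tonelli1// [RHS]fubini_tonelli2//.
apply: (measurableT_comp mF); apply/measurable_fun_pair => /=.
  exact: measurable_snd.
exact: measurable_fst.
Qed.

(** Test functions whose logarithm is bounded on their support: these are the
    ones to which the Chernoff bound applies. *)
Definition bounded_away d (X : measurableType d) (R : realType) (f : X -> R)
    (n : nat) : Prop :=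
  forall x, f x = 0 \/ n.+1%:R^-1 <= f x <= n.+1%:R.

Section quadratic_form.
Context d (T : measurableType d) (R : realType) (mu : probability T R).
Variable W : T * T -> R.
Hypothesis hW : graphon W.
Local Open Scope ereal_scope.

Let mW : measurable_fun setT W. Proof. by case: hW. Qed.
Let sW x y : W (x, y) = W (y, x). Proof. by case: hW. Qed.
Let W0 z : (0 <= W z)%R. Proof. by case: hW => _ _ /(_ z)/andP[]. Qed.
Let W1 z : (W z <= 1)%R. Proof. by case: hW => _ _ /(_ z)/andP[]. Qed.

Definition kernel_form (f g : T -> R) :=
  \int[mu \x mu]_z (f z.1 * W z * g z.2)%:E.
Definition sqnorm (f : T -> R) := \int[mu]_x (f x ^+ 2)%:E.

Lemma measurable_kernel_form (f g : T -> R) :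
    measurable_fun setT f -> measurable_fun setT g ->
  measurable_fun setT (fun z => f z.1 * W z * g z.2)%R.
Proof.
move=> mf mg; apply: measurable_funM; last exact: (measurableT_comp mg).
by apply: measurable_funM => //; exact: (measurableT_comp mf).
Qed.

Lemma kernel_formC (f g : T -> R) :
    measurable_fun setT f -> (forall x, 0 <= f x)%R ->
    measurable_fun setT g -> (forall x, 0 <= g x)%R ->
  kernel_form f g = kernel_form g f.
Proof.
move=> mf f0 mg g0; rewrite /kernel_form ge0_integral_swap; last 2 first.
- by apply/measurable_EFinP; exact: measurable_kernel_form.
- by move=> z; rewrite lee_fin !mulr_ge0.
by apply: eq_integral => -[x y] _ /=; rewrite sW mulrC mulrA mulrAC.
Qed.

Section bound.
Variable w : R.
Hypothesis w0 : (0 <= w)%R.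
Hypothesis form_le : forall n (f : T -> R), measurable_fun setT f ->
  bounded_away f n -> kernel_form f f <= w%:E * sqnorm f.

(** Truncating [f] to the set where it lies between [1/(n+1)] and [n+1] gives an
    increasing sequence of test functions, hence monotone convergence. *)
Lemma kernel_form_le_sqnorm (f : T -> R) :
    measurable_fun setT f -> (forall x, 0 <= f x)%R ->
  kernel_form f f <= w%:E * sqnorm f.
Proof.
move=> mf f0.
pose A n := [set x | n.+1%:R^-1 <= f x <= n.+1%:R]%R.
have mA n : measurable (A n).
  rewrite (_ : A n = f @^-1` `[(n.+1%:R^-1)%R, n.+1%:R%R]%classic); last first.
    by apply/seteqP; split => x; rewrite /A/= in_itv.
  by rewrite -[X in measurable X]setTI; apply: mf.
pose fn n x := (f x * \1_(A n) x)%R.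
have mfn n : measurable_fun setT (fn n).
  by apply: measurable_funM => //; exact: measurable_indic.
have fn0 n x : (0 <= fn n x)%R by rewrite mulr_ge0.
have fn_away n : bounded_away (fn n) n.
  move=> x; rewrite /fn indicE; case: (boolP (x \in A n)); rewrite ?mulr0 ?mulr1.
    by rewrite inE => ?; right.
  by left.
have fn_le n x : (fn n x <= f x)%R.
  by rewrite /fn indicE; case: (x \in A n); rewrite ?mulr1// mulr0.
have fn_nd x m n : (m <= n)%N -> (fn m x <= fn n x)%R.
  move=> mn; rewrite ler_wpM2l// !indicE ler_nat.
  case: (boolP (x \in A m)) => // /set_mem /andP[h1 h2].
  rewrite mem_set//=; apply/andP; split.
    by apply: le_trans h1; rewrite lef_pV2 ?posrE// ler_nat.
  by apply: (le_trans h2); rewrite ler_nat.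
have fn_cvg x : \forall n \near \oo, fn n x = f x.
  have [fx0|fx0] := eqVneq (f x) 0%R.
    by apply: nearW => n; rewrite /fn fx0 mul0r.
  have fx_gt0 : (0 < f x)%R by rewrite lt_neqAle eq_sym fx0 f0.
  near=> n; rewrite /fn indicE mem_set ?mulr1//=; apply/andP; split.
    rewrite -[leRHS]invrK lef_pV2 ?posrE ?invr_gt0//.
    rewrite (@le_trans _ _ n%:R)// ?ler_nat//.
    by near: n; exact: nbhs_infty_ger.
  rewrite (@le_trans _ _ n%:R)// ?ler_nat//.
  by near: n; exact: nbhs_infty_ger.
pose F n z : \bar R := (fn n z.1 * W z * fn n z.2)%:E.
have F_lim z : limn (F ^~ z) = (f z.1 * W z * f z.2)%:E.
  apply/cvg_lim => //; apply: cvg_near_cst.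
  near=> n; rewrite /F; congr (_ * _ * _)%:E.
    by near: n; exact: fn_cvg.
  by near: n; exact: fn_cvg.
have F_int n : \int[mu \x mu]_z F n z <= w%:E * sqnorm f.
  apply: (le_trans (form_le (mfn n) (fn_away n))).
  rewrite lee_wpmul2l ?lee_fin//; apply: ge0_le_integral_EFin => [|x||x].
  - exact: measurable_funX.
  - exact: sqr_ge0.
  - exact: measurable_funX.
  - by rewrite lerXn2r ?nnegrE.
have ndF z : nondecreasing_seq (F ^~ z).
  move=> m n mn; rewrite lee_fin ler_pM ?mulr_ge0//; last exact: fn_nd.
  by rewrite ler_wpM2r//; exact: fn_nd.
have mF n : measurable_fun setT (F n).
  by apply/measurable_EFinP; exact: measurable_kernel_form.
have F0 n z : 0 <= F n z by rewrite lee_fin !mulr_ge0.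
rewrite [kernel_form f f](_ : _ = \int[mu \x mu]_z limn (F ^~ z)); last first.
  by apply: eq_integral => z _; rewrite F_lim.
rewrite monotone_convergence//; apply: lime_le; last exact: nearW.
apply: ereal_nondecreasing_is_cvgn => m n mn.
apply: ge0_le_integral => // z _; exact: ndF.
Unshelve. all: by end_near. Qed.

(** Polarization.  The identity
    [2 (f x * g y + g x * f y) = (f + g) x * (f + g) y - (f - g) x * (f - g) y]
    would require a lower bound on the form at [f - g]; since [W] is
    nonnegative, replacing [f - g] by its absolute value suffices. *)
Lemma kernel_form_le_sqnormD (f g : T -> R) :
    measurable_fun setT f -> (forall x, 0 <= f x)%R ->
    measurable_fun setT g -> (forall x, 0 <= g x)%R ->
  2%:E * kernel_form f g <= w%:E * (sqnorm f + sqnorm g).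
Proof.
move=> mf f0 mg g0.
pose a x := (f x + g x)%R; pose b x := `|f x - g x|%R.
have ma : measurable_fun setT a by exact: measurable_funD.
have mb : measurable_fun setT b.
  by apply: measurableT_comp => //; exact: measurable_funB.
have a0 x : (0 <= a x)%R by exact: addr_ge0.
have b0 x : (0 <= b x)%R by exact: normr_ge0.
have sqnormD u v : measurable_fun setT u -> measurable_fun setT v ->
    sqnorm u + sqnorm v = \int[mu]_x (u x ^+ 2 + v x ^+ 2)%:E.
  move=> mu_ mv; rewrite ge0_integralD_EFin//; try exact: measurable_funX.
  - by move=> x; exact: sqr_ge0.
  - by move=> x; exact: sqr_ge0.
rewrite -(@lee_pmul2l _ 2%:E) ?lte_fin//.
have -> : 2%:E * (2%:E * kernel_form f g) = \int[mu \x mu]_z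
    (2 * (f z.1 * W z * g z.2) + 2 * (g z.1 * W z * f z.2))%:E.
  have mfg := measurable_kernel_form mf mg; have mgf := measurable_kernel_form mg mf.
  rewrite ge0_integralD_EFin; [|exact: measurable_funM|
    by move=> z; rewrite !mulr_ge0|exact: measurable_funM|
    by move=> z; rewrite !mulr_ge0].
  rewrite !ge0_integralM_EFin//; try by move=> z; rewrite !mulr_ge0.
  rewrite -/(kernel_form f g) -/(kernel_form g f) (kernel_formC mg g0 mf f0).
  by rewrite -ge0_muleDl ?lee_fin// -EFinD muleA -EFinM; congr (_%:E * _); ring.
apply: (@le_trans _ _ (kernel_form a a + kernel_form b b)).
  rewrite /kernel_form -ge0_integralD_EFin; [|exact: measurable_kernel_form|
    by move=> z; rewrite !mulr_ge0|exact: measurable_kernel_form|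
    by move=> z; rewrite !mulr_ge0].
  apply: ge0_le_integral_EFin => [|z||[x y]/=].
  - by apply: measurable_funD; apply: measurable_funM => //;
      exact: measurable_kernel_form.
  - by rewrite addr_ge0// !mulr_ge0.
  - by apply: measurable_funD; exact: measurable_kernel_form.
  have : (- ((f x - g x) * (f y - g y)) <= b x * b y)%R.
    by rewrite -normrM -normrN ler_norm.
  move=> /(ler_wpM2r (W0 (x, y))); rewrite -subr_ge0 => h; rewrite -subr_ge0.
  by apply: le_trans h _; rewrite le_eqVlt; apply/orP; left; apply/eqP;
    rewrite /a; ring.
apply: (le_trans (leeD (kernel_form_le_sqnorm ma a0) (kernel_form_le_sqnorm mb b0))).
rewrite -ge0_muleDr; [|by apply: integral_ge0 => x _; rewrite lee_fin sqr_ge0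
  |by apply: integral_ge0 => x _; rewrite lee_fin sqr_ge0].
rewrite [leRHS]muleCA lee_wpmul2l ?lee_fin// !sqnormD//.
rewrite -ge0_integralM_EFin//; [|by apply: measurable_funD; exact: measurable_funX
  |by move=> x; rewrite addr_ge0 ?sqr_ge0].
rewrite le_eqVlt; apply/orP; left; apply/eqP; apply: eq_integral => x _.
by rewrite /a /b real_normK ?num_real//; congr EFin; ring.
Qed.

(** The pair [g = T_W |f|] and [|f|] tests the norm: [<g, T_W |f|> = |g|^2], and
    polarization with [|f|] scaled by [s = |g|] reads
    [2 s^3 <= w (s^2 + s^2)]. *)
Lemma norm2_kernel_op_le (f : T -> R) : f \in Lfun mu 2%:E ->
  'N[mu]_2%:E[EFin \o f] <= 1 ->
  'N[mu]_2%:E[EFin \o kernel_op mu W f] <= w%:E.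
Proof.
move=> f2 Nf1.
have intf : mu.-integrable setT (EFin \o f).
  apply/Lfun1_integrable; apply: Lfun_subset12 => //.
  exact: fin_num_measure.
have mf : measurable_fun setT f.
  by apply/measurable_EFinP; exact: measurable_int intf.
pose h x := `|f x|%R.
have mh : measurable_fun setT h by exact: measurableT_comp.
have inth : mu.-integrable setT (EFin \o h) by exact: integrable_norm.
have h0 x : (0 <= h x)%R by exact: normr_ge0.
pose g := kernel_op mu W h.
have mg : measurable_fun setT g by exact: measurable_kernel_op.
have g0 x : (0 <= g x)%R by apply: Rintegral_ge0 => y _; rewrite mulr_ge0.
pose M := (\int[mu]_x h x)%R.
have ME : M%:E = \int[mu]_x (h x)%:E.
  by rewrite /M /Rintegral fineK//; exact: integrable_fin_num.
have gM x : (g x <= M)%R.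
  rewrite -lee_fin ME kernel_opE//; apply: ge0_le_integral_EFin => //.
  - by apply: measurable_funM => //; exact: measurableT_comp.
  - by move=> y; rewrite mulr_ge0.
  - by move=> y; rewrite ler_piMl.
have hN : sqnorm h <= 1.
  rewrite -[leLHS]norm2_sqr (@eq_Lnorm _ _ _ _ _ _ (abse \o (EFin \o f)))//.
  rewrite Lnorm_abse -(@poweR1r R 2); apply: gt0_ler_poweR => //.
    by rewrite in_itv/= Lnorm_ge0 leey.
  by rewrite in_itv/= lee_fin ler01 leey.
have gfin : sqnorm g \is a fin_num.
  rewrite ge0_fin_numE; last first.
    by apply: integral_ge0 => x _; rewrite lee_fin sqr_ge0.
  apply: (@le_lt_trans _ _ (\int[mu]_(_ in setT) (M ^+ 2)%:E)).
    apply: (@ge0_le_integral_EFin _ _ _ _ _ (cst (M ^+ 2))%R) => // [|x|x].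
    - exact: measurable_funX.
    - exact: sqr_ge0.
    - by rewrite lerXn2r ?nnegrE// (le_trans (g0 x)).
  by rewrite integral_prob_cst ltry.
pose s2 := fine (sqnorm g).
have s2E : sqnorm g = s2%:E by rewrite fineK.
have s20 : (0 <= s2)%R.
  by rewrite -lee_fin -s2E; apply: integral_ge0 => x _; rewrite lee_fin sqr_ge0.
have formg : kernel_form g h = s2%:E.
  rewrite -s2E /kernel_form fubini_tonelli1//; last 2 first.
  - by apply/measurable_EFinP; exact: measurable_kernel_form.
  - by move=> z; rewrite lee_fin !mulr_ge0.
  apply: eq_integral => x _; rewrite /fubini_F/=.
  under eq_integral do rewrite -mulrA.
  rewrite ge0_integralM_EFin//; last 2 first.
  - by apply: measurable_funM => //; exact: measurableT_comp.
  - by move=> y; rewrite mulr_ge0.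
  by rewrite -kernel_opE// -EFinM expr2.
pose s := Num.sqrt s2.
have s0 : (0 <= s)%R by exact: sqrtr_ge0.
have ss : (s ^+ 2 = s2)%R by exact: sqr_sqrtr.
have sw : (s <= w)%R.
  have msh : measurable_fun setT (fun x => s * h x)%R.
    exact: measurable_funM.
  have := kernel_form_le_sqnormD mg g0 msh (fun x => mulr_ge0 s0 (h0 x)).
  rewrite (_ : kernel_form _ _ = s%:E * kernel_form g h); last first.
    rewrite /kernel_form -ge0_integralM_EFin//; last 2 first.
    - exact: measurable_kernel_form.
    - by move=> z; rewrite !mulr_ge0.
    by apply: eq_integral => z _; congr EFin; ring.
  rewrite (_ : sqnorm (fun x => s * h x)%R = (s ^+ 2)%:E * sqnorm h); last first.
    rewrite /sqnorm -ge0_integralM_EFin ?sqr_ge0//; last 2 first.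
    - exact: measurable_funX.
    - by move=> x; exact: sqr_ge0.
    by apply: eq_integral => x _; rewrite exprMn.
  rewrite formg s2E => hle.
  have : 2%:E * (s%:E * s2%:E) <= w%:E * (s2%:E + (s ^+ 2)%:E * 1).
    apply: (le_trans hle); rewrite lee_wpmul2l ?lee_fin// leeD2l//.
    by rewrite lee_wpmul2l// lee_fin sqr_ge0.
  rewrite mule1 -EFinD -!EFinM lee_fin ss -ss => hs.
  have [-> //|s_neq0] := eqVneq s 0%R.
  have s_gt0 : (0 < s ^+ 2)%R by rewrite exprn_gt0// lt_neqAle eq_sym s_neq0.
  by rewrite -(ler_pM2r s_gt0); lra.
apply: (@le_trans _ _ s%:E); last by rewrite lee_fin.
have -> : s%:E = 'N[mu]_2%:E[EFin \o g].
  by rewrite norm2E -/(sqnorm g) s2E poweR_EFin powR12_sqrt.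
have mTf : measurable_fun setT (kernel_op mu W f) by exact: measurable_kernel_op.
rewrite !norm2E; apply: gt0_ler_poweR => //; rewrite ?in_itv/= ?leey ?andbT.
- by apply: integral_ge0 => x _; rewrite lee_fin sqr_ge0.
- by apply: integral_ge0 => x _; rewrite lee_fin sqr_ge0.
apply: ge0_le_integral_EFin => [|x||x].
- exact: measurable_funX.
- exact: sqr_ge0.
- exact: measurable_funX.
rewrite -[leLHS]real_normK ?num_real// lerXn2r ?nnegrE//.
apply: (le_trans (le_normr_Rintegral _ _)) => //.
  exact: integrable_kernel.
rewrite le_eqVlt; apply/orP; left; apply/eqP; apply: eq_Rintegral => y _.
by rewrite normrM (ger0_norm (W0 _)).
Qed.

Lemma rho_le : rho mu W <= w%:E.
Proof.
by apply: ub_ereal_sup => _ [f [f2 Nf1] <-]; exact: norm2_kernel_op_le.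
Qed.

End bound.

Lemma lt_rho_bounded_away (r : R) : (0 <= r)%R -> r%:E < rho mu W ->
  exists n (f : T -> R), [/\ measurable_fun setT f, bounded_away f n &
    r%:E * sqnorm f < kernel_form f f].
Proof.
move=> r0; apply: contraPP => noex; apply/negP; rewrite -leNgt.
apply: rho_le => // n f mf fn; rewrite leNgt; apply/negP => hlt.
by apply: noex; exists n, f.
Qed.

Lemma rho_le1 : rho mu W <= 1.
Proof.
apply: rho_le => // n f mf fn.
have f0 x : (0 <= f x)%R.
  by case: (fn x) => [->//|/andP[+ _]]; apply: le_trans; rewrite invr_ge0.
have mf2 : measurable_fun setT (fun x => f x ^+ 2)%R by exact: measurable_funX.
have f20 x : (0 <= f x ^+ 2)%R by exact: sqr_ge0.
pose c := (2^-1 : R)%R.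
have c0 : (0 <= c)%R by rewrite invr_ge0.
have m1 : measurable_fun setT (fun z : T * T => f z.1 ^+ 2)%R.
  exact: (measurableT_comp mf2).
have m2 : measurable_fun setT (fun z : T * T => f z.2 ^+ 2)%R.
  exact: (measurableT_comp mf2).
rewrite mul1e; apply: (@le_trans _ _
    (\int[mu \x mu]_z (c * f z.1 ^+ 2 + c * f z.2 ^+ 2)%:E)).
  apply: ge0_le_integral_EFin => [|z||z].
  - exact: measurable_kernel_form.
  - by rewrite !mulr_ge0.
  - by apply: measurable_funD; exact: measurable_funM.
  - apply: (@le_trans _ _ (f z.1 * f z.2)%R).
      by rewrite ler_wpM2r// ler_piMr.
    have := sqr_ge0 (f z.1 - f z.2)%R; rewrite /c => h.
    by rewrite -subr_ge0 (_ : _ - _ = (f z.1 - f z.2) ^+ 2 / 2)%R;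
      [rewrite divr_ge0|field].
rewrite ge0_integralD_EFin; [|exact: measurable_funM|
  by move=> z; rewrite mulr_ge0|exact: measurable_funM|
  by move=> z; rewrite mulr_ge0].
rewrite !ge0_integralM_EFin// [X in _ + _ * X]ge0_integral_swap/=; last 2 first.
- exact/measurable_EFinP.
- by move=> z; rewrite lee_fin.
rewrite (_ : \int[mu \x mu]_z (f z.1 ^+ 2)%:E = sqnorm f); last first.
  rewrite fubini_tonelli1//; last 2 first.
  - exact/measurable_EFinP.
  - by move=> z; rewrite lee_fin.
  by apply: eq_integral => x _; rewrite /fubini_F/= integral_prob_cst.
rewrite -ge0_muleDl ?lee_fin// -EFinD (_ : c + c = 1)%R ?mul1e//.
by rewrite /c; lra.
Qed.
End quadratic_form.

(** * Centering the logarithm *)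

(** From [1 - u <= exp (- u)], by inversion. *)
Lemma expR_le1Dx2 (R : realType) (u : R) : u <= 2^-1 ->
  expR u <= 1 + u + 2 * u ^+ 2.
Proof.
move=> u2.
have u1 : 0 < 1 - u by lra.
apply: (@le_trans _ _ (1 - u)^-1).
  by rewrite -[leLHS]invrK lef_pV2 ?posrE ?invr_gt0 ?expR_gt0// -expRN expR_ge1Dx.
rewrite -div1r ler_pdivrMr// -subr_ge0 (_ : _ - 1 = u ^+ 2 * (1 - 2 * u)); last by ring.
by rewrite mulr_ge0 ?sqr_ge0//; lra.
Qed.

(** Chernoff-type bound: when [h] has mean zero for the density [q], the linear
    term of [exp (t h)] integrates to zero and only a second-order term
    remains. *)
Lemma weighted_mgf_le d (X : measurableType d) (R : realType)
    (P : probability X R) (q h : X -> R) (B C t : R) :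
    measurable_fun setT q -> (forall x, 0 <= q x <= B) ->
    measurable_fun setT h -> (forall x, `|h x| <= C) ->
    \int[P]_x (q x * h x) = 0 -> `|t| * C <= 2^-1 ->
  (\int[P]_x (q x * expR (t * h x))%:E <=
   (\int[P]_x q x * expR (2 * (t * C) ^+ 2))%:E)%E.
Proof.
move=> mq q01 mh hC qh0 tC.
have q0 x : 0 <= q x by case/andP: (q01 x).
have qB x : q x <= B by case/andP: (q01 x).
have intq : P.-integrable setT (EFin \o q).
  by apply: (@bounded_integrable _ _ _ _ _ B) => // x; rewrite ger0_norm.
have intqh : P.-integrable setT (EFin \o (fun x => q x * h x)).
  apply: (@bounded_integrable _ _ _ _ _ (B * C)) => [|x].
    exact: measurable_funM.
  by rewrite normrM ger0_norm// ler_pM.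
have th x : t * h x <= 2^-1.
  apply: (le_trans (ler_norm _)); rewrite normrM.
  by apply: le_trans tC; rewrite ler_wpM2l.
pose c := 1 + 2 * (t * C) ^+ 2.
apply: (@le_trans _ _ (\int[P]_x (c * q x + t * (q x * h x))%:E)%E).
  apply: ge0_le_integral_EFin => [|x||x].
  - apply: measurable_funM => //; apply: measurableT_comp => //.
    exact: measurable_funM.
  - by rewrite mulr_ge0// expR_ge0.
  - by apply: measurable_funD; apply: measurable_funM => //;
      exact: measurable_funM.
  - apply: (@le_trans _ _ (q x * (1 + t * h x + 2 * (t * h x) ^+ 2))).
      by rewrite ler_wpM2l// expR_le1Dx2.
    rewrite (_ : c * q x + _ = q x * (1 + t * h x + 2 * (t * C) ^+ 2)); last first.
      by rewrite /c; ring.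
    rewrite ler_wpM2l// lerD2l ler_wpM2l// !exprMn ler_wpM2l ?sqr_ge0//.
    rewrite -[leLHS]real_normK ?num_real// lerXn2r// nnegrE//.
    exact: le_trans (hC x).
rewrite -(@fineK _ (\int[P]_x _)%E); last first.
  apply: integrable_fin_num => //.
  exact: (integrableD _ (integrableZl _ c intq) (integrableZl _ t intqh)).
rewrite lee_fin -/(Rintegral _ _ _) RintegralD//; last 2 first.
- exact: (integrableZl _ c intq).
- exact: (integrableZl _ t intqh).
rewrite !RintegralZl// qh0 mulr0 addr0 mulrC ler_wpM2l ?Rintegral_ge0//.
exact: expR_ge1Dx.
Qed.

(** The last clause says that [ln g] has mean zero for the density
    [g x * W (x, y) * g y].  Where [g] vanishes, [ln g] has the default value
    [0], so the bound on [ln g] does not force [g] to be positive. *)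
Definition tilted_function d (T : measurableType d) (R : realType)
    (mu : probability T R) (W : T * T -> R) (C : R) (g : T -> R) : Prop :=
  [/\ measurable_fun setT g, forall x, 0 <= g x, forall x, g x <= expR C,
      forall x, `|ln (g x)| <= C &
      \int[(mu \x mu)%E]_z (g z.1 * W z * g z.2 * ln (g z.1)) = 0].

Section lower_bound.
Context d (T : measurableType d) (R : realType) (mu : probability T R).
Variable W : T * T -> R.
Hypothesis hW : graphon W.

Let W0 z : 0 <= W z. Proof. by case: hW => _ _ /(_ z)/andP[]. Qed.
Let W1 z : W z <= 1. Proof. by case: hW => _ _ /(_ z)/andP[]. Qed.
Let mu2 : probability (T * T)%type R := (mu \x mu)%E.

(** Multiplying [f] by [exp (- E)], where [E] is the mean of [ln f] for the
    density [f x * W (x, y) * f y], centers the logarithm and changes both sides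
    of the strict inequality by the same factor. *)
Lemma exists_tilted_function (r : R) : 0 <= r -> (r%:E < rho mu W)%E ->
  exists C (g : T -> R), [/\ 0 <= C, tilted_function mu W C g &
    (r%:E * sqnorm mu g < kernel_form mu W g g)%E].
Proof.
move=> r0 /(lt_rho_bounded_away hW r0)[n [f [mf fn fr]]].
have f0 x : 0 <= f x.
  by case: (fn x) => [->//|/andP[+ _]]; apply: le_trans; rewrite invr_ge0.
have fn1 x : f x <= n.+1%:R by case: (fn x) => [->//|/andP[]].
have lnf x : `|ln (f x)| <= ln n.+1%:R.
  case: (fn x) => [->|/andP[h1 h2]].
    by rewrite ln0// normr0 ln_ge0// ler1n.
  have fx0 : 0 < f x by apply: lt_le_trans h1; rewrite invr_gt0.
  rewrite ler_norml -lnV ?posrE// !ler_ln ?posrE ?invr_gt0//.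
  by rewrite h1 h2.
pose q z := f z.1 * W z * f z.2.
have mq : measurable_fun setT q by exact: measurable_kernel_form.
have q0 z : 0 <= q z by rewrite !mulr_ge0.
have qB z : `|q z| <= n.+1%:R ^+ 2.
  rewrite ger0_norm// expr2 /q ler_pM ?mulr_ge0//.
  by rewrite -[leRHS]mulr1 ler_pM.
have intq : mu2.-integrable setT (EFin \o q) by exact: bounded_integrable qB.
have mlnf : measurable_fun setT (fun z : T * T => ln (f z.1)).
  by apply: measurableT_comp => //; exact: (measurableT_comp mf).
have intqln : mu2.-integrable setT (EFin \o (fun z => q z * ln (f z.1))).
  apply: (@bounded_integrable _ _ _ _ _ (n.+1%:R ^+ 2 * ln n.+1%:R)) => [|z].
    exact: measurable_funM.
  by rewrite normrM ler_pM.
pose l := \int[mu2]_z q z.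
have lE : kernel_form mu W f f = l%:E.
  by rewrite /l /Rintegral fineK//; exact: integrable_fin_num.
have l0 : 0 < l.
  rewrite -lte_fin -lE; apply: le_lt_trans fr; rewrite mule_ge0//.
  by apply: integral_ge0 => x _; rewrite lee_fin sqr_ge0.
pose E := (\int[mu2]_z (q z * ln (f z.1))) / l.
pose c := expR (- E); have c0 : 0 < c by exact: expR_gt0.
pose g x := c * f x.
have mg : measurable_fun setT g by exact: measurable_funM.
have g0 x : 0 <= g x by rewrite mulr_ge0// ltW.
have lng x : f x != 0 -> ln (g x) = ln (f x) - E.
  move=> fx0; rewrite lnM ?posrE//; last by rewrite lt_neqAle eq_sym fx0 f0.
  by rewrite /c expRK addrC.
have C0 : 0 <= ln n.+1%:R + `|E| by rewrite addr_ge0// ln_ge0// ler1n.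
have lngC x : `|ln (g x)| <= ln n.+1%:R + `|E|.
  have [fx0|fx0] := eqVneq (f x) 0; last first.
    by rewrite lng// (le_trans (ler_normB _ _))// lerD2r.
  by rewrite /g fx0 mulr0 ln0// normr0.
exists (ln n.+1%:R + `|E|), g; split => //.
- split => // [x|].
    have [fx0|fx0] := eqVneq (f x) 0; first by rewrite /g fx0 mulr0 expR_ge0.
    rewrite -[leLHS]lnK ?posrE.
      by rewrite ler_expR (le_trans (ler_norm _)).
    by rewrite mulr_gt0// lt_neqAle eq_sym fx0 f0.
  transitivity (\int[mu2]_z (c ^+ 2 * (q z * ln (f z.1) - E * q z))).
    apply: eq_Rintegral => z _; have [fx0|fx0] := eqVneq (f z.1) 0.
      by rewrite /q /g fx0; ring.
    by rewrite lng// /q /g; ring.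
  rewrite RintegralZl//; last first.
    exact: (integrableB _ intqln (integrableZl _ E intq)).
  rewrite RintegralB//; last exact: (integrableZl _ E intq).
  by rewrite RintegralZl// -/l /E divfK ?gt_eqF// subrr mulr0.
- have -> : kernel_form mu W g g = ((c ^+ 2)%:E * kernel_form mu W f f)%E.
    rewrite /kernel_form -ge0_integralM_EFin ?sqr_ge0//.
    by apply: eq_integral => z _; rewrite /g; congr EFin; ring.
  have -> : sqnorm mu g = ((c ^+ 2)%:E * sqnorm mu f)%E.
    rewrite /sqnorm -ge0_integralM_EFin ?sqr_ge0//; last 2 first.
    - exact: measurable_funX.
    - by move=> x; exact: sqr_ge0.
    by apply: eq_integral => z _; rewrite /g; congr EFin; ring.
  by rewrite muleCA lte_pmul2l// lte_fin exprn_gt0.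
Qed.

End lower_bound.

(** * Typical sets and the concentration inequality *)

Section typical_set.
Context d (T : measurableType d) (R : realType).
Variables (W : T * T -> R) (g : T -> R).
Hypotheses (W0 : forall z, 0 <= W z) (g0 : forall x, 0 <= g x).

Definition weight z := g z.1 * W z * g z.2.
Definition prod_fun k (x : k.-tuple T) := \prod_(i < k) g (tnth x i).
Definition log_sum k (x : k.-tuple T) := \sum_(i < k) ln (g (tnth x i)).
Definition typical_set k (th : R) : set (k.-tuple T) :=
  [set x | prod_fun x != 0 /\ `|log_sum x| <= th].
(** Exponential tilts of the weight in the first and in the second variable;
    their tensor powers are the weights multiplied by [exp (t * log_sum)] of the
    corresponding tuple. *)
Definition tilt1 (t : R) z := weight z * expR (t * ln (g z.1)).
Definition tilt2 (t : R) z := weight z * expR (t * ln (g z.2)).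

Lemma weight_ge0 z : 0 <= weight z.
Proof. by rewrite !mulr_ge0. Qed.

Lemma prod_fun_expR k (x : k.-tuple T) :
  prod_fun x != 0 -> prod_fun x = expR (log_sum x).
Proof.
move=> /prodf_neq0 gx0; rewrite expR_sum; apply: eq_bigr => i _.
by rewrite lnK// posrE lt_neqAle eq_sym gx0 ?g0.
Qed.

Lemma tensor_power_weight k (z : k.-tuple T * k.-tuple T) :
  tensor_power weight z = prod_fun z.1 * tensor_power W z * prod_fun z.2.
Proof. by rewrite /tensor_power /weight !big_split. Qed.

Lemma tensor_power_tilt1 k t (z : k.-tuple T * k.-tuple T) :
  tensor_power (tilt1 t) z = tensor_power weight z * expR (t * log_sum z.1).
Proof. by rewrite /tensor_power big_split/= mulr_sumr expR_sum. Qed.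

Lemma tensor_power_tilt2 k t (z : k.-tuple T * k.-tuple T) :
  tensor_power (tilt2 t) z = tensor_power weight z * expR (t * log_sum z.2).
Proof. by rewrite /tensor_power big_split/= mulr_sumr expR_sum. Qed.

(** Markov's inequality for both tails, before integration. *)
Lemma expR_tail (t th a : R) : 0 <= t -> th <= `|a| ->
  1 <= expR (- (t * th)) * (expR (t * a) + expR (- t * a)).
Proof.
move=> t0 tha.
have key b : th <= b -> 1 <= expR (- (t * th)) * expR (t * b).
  move=> thb; rewrite -expRD -[leLHS]expR0 ler_expR addrC subr_ge0.
  by rewrite ler_wpM2l.
rewrite mulrDr; have [a0|a0] := leP 0 a.
  rewrite (le_trans (key a _)) ?lerDl ?mulr_ge0 ?expR_ge0//.
  by rewrite ger0_norm in tha.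
rewrite mulNr -mulrN (le_trans (key (- a) _)) ?lerDr ?mulr_ge0 ?expR_ge0//.
by rewrite ltr0_norm in tha.
Qed.

(** If both tuples are typical, the product functions are at most [exp th]
    each; otherwise the tilts in the variable of an atypical tuple exceed the
    weight. *)
Lemma tensor_power_weight_le k (t th : R) (z : k.-tuple T * k.-tuple T) :
    0 <= t ->
  tensor_power weight z <=
  expR (2 * th) *
    (\1_(typical_set th) z.1 * tensor_power W z * \1_(typical_set th) z.2) +
  expR (- (t * th)) *
    (tensor_power (tilt1 t) z + tensor_power (tilt1 (- t)) z +
     (tensor_power (tilt2 t) z + tensor_power (tilt2 (- t)) z)).
Proof.
case: z => x y t0; set q := tensor_power weight (x, y).
rewrite (_ : _ + (_ + _) = q * (expR (t * log_sum x) + expR (- t * log_sum x) +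
    (expR (t * log_sum y) + expR (- t * log_sum y)))); last first.
  by rewrite !mulrDr; congr (_ + _ + (_ + _));
    rewrite ?(tensor_power_tilt1, tensor_power_tilt2).
have q0 : 0 <= q by apply: tensor_power_ge0 => z; exact: weight_ge0.
have w0 : 0 <= tensor_power W (x, y) by exact: tensor_power_ge0.
have e0 (a : R) : 0 <= expR a by exact: expR_ge0.
rewrite [X in _ + X]mulrCA.
have [->|qn0] := eqVneq q 0; first by rewrite mul0r addr0 !mulr_ge0.
have [Fx Fy] : prod_fun x != 0 /\ prod_fun y != 0.
  move: qn0; rewrite /q tensor_power_weight/= !mulf_eq0 !negb_or.
  by move=> /andP[/andP[]].
have [xS|xS] := boolP (`|log_sum x| <= th); last first.
  rewrite -[leLHS]add0r lerD ?mulr_ge0//.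
  rewrite -[leLHS]mulr1 ler_wpM2l// mulrDr.
  rewrite (le_trans (expR_tail t0 (a := log_sum x) (th := th) _))
    ?lerDl ?mulr_ge0 ?addr_ge0//.
  by rewrite ltW// ltNge.
have [yS|yS] := boolP (`|log_sum y| <= th); last first.
  rewrite -[leLHS]add0r lerD ?mulr_ge0//.
  rewrite -[leLHS]mulr1 ler_wpM2l// mulrDr.
  rewrite (le_trans (expR_tail t0 (a := log_sum y) (th := th) _))
    ?lerDr ?mulr_ge0 ?addr_ge0//.
  by rewrite ltW// ltNge.
rewrite !indicE !mem_set//= mul1r mulr1 -[leLHS]addr0 lerD//; last first.
  by rewrite !mulr_ge0// ?addr_ge0// addr_ge0.
rewrite /q tensor_power_weight/= mulrAC ler_wpM2r//.
rewrite (prod_fun_expR Fx) (prod_fun_expR Fy).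
rewrite -expRD ler_expR mulr_natl mulr2n lerD//.
  exact: le_trans (ler_norm _) xS.
exact: le_trans (ler_norm _) yS.
Qed.

Hypothesis mg : measurable_fun setT g.

Lemma measurable_prod_fun k : measurable_fun setT (@prod_fun k).
Proof.
apply: measurable_prod => i _.
exact: (measurableT_comp mg (@measurable_tnth _ T _ i)).
Qed.

Lemma measurable_log_sum k : measurable_fun setT (@log_sum k).
Proof.
apply: measurable_sum => i; apply: measurableT_comp => //.
exact: (measurableT_comp mg (@measurable_tnth _ T _ i)).
Qed.

Lemma measurable_typical_set k th : measurable (@typical_set k th).
Proof.
rewrite (_ : typical_set th = (@prod_fun k @^-1` (~` [set 0])) `&`
    ((Num.norm \o @log_sum k) @^-1` `]-oo, th]%classic)); last first.
  apply/seteqP; split=> x; rewrite /typical_set/= in_itv/=.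
    by case=> /eqP ? ?; split.
  by case=> /eqP ? ?; split.
apply: measurableI; rewrite -[X in measurable X]setTI.
  by apply: measurable_prod_fun => //; exact: measurableC.
have mn : measurable_fun setT (Num.norm \o @log_sum k).
  by apply: measurableT_comp => //; exact: measurable_log_sum.
by apply: mn.
Qed.

Lemma indic_typical_set_le k th (x : k.-tuple T) :
  \1_(typical_set th) x <= expR (2 * th) * prod_fun x ^+ 2.
Proof.
rewrite indicE; case: (boolP (x \in _)); last first.
  by rewrite mulr_ge0// ?expR_ge0// sqr_ge0.
move=> /set_mem [Fx Hx]; rewrite prod_fun_expR// -expRM_natl -expRD/=.
rewrite -[leLHS]expR0 ler_expR -mulrDr mulr_ge0// -lerBlDr sub0r.
by rewrite lerNl; move: Hx; rewrite ler_norml => /andP[].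
Qed.

End typical_set.

Section density_lower_bound.
Context d (T : measurableType d) (R : realType) (mu : probability T R).
Variable W : T * T -> R.
Hypothesis hW : graphon W.
Local Open Scope ereal_scope.

Let sW x y : W (x, y) = W (y, x). Proof. by case: hW. Qed.
Let W0 z : (0 <= W z)%R. Proof. by case: hW => _ _ /(_ z)/andP[]. Qed.
Let W1 z : (W z <= 1)%R. Proof. by case: hW => _ _ /(_ z)/andP[]. Qed.

Lemma integral_tensor_power_le (G : T * T -> R) (m : R) k :
    measurable_fun setT G -> (forall p, 0 <= G p)%R ->
    \int[mu \x mu]_p (G p)%:E <= m%:E ->
  \int[power_prob mu k \x power_prob mu k]_z (tensor_power G z)%:E <=
  (m ^+ k)%:E.
Proof.
move=> mG G0 Gm; rewrite ge0_integral_tensor_power// EFin_expe.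
have I0 : 0 <= \int[mu \x mu]_p (G p)%:E.
  by apply: integral_ge0 => p _; rewrite lee_fin.
by elim: k => [//|k IH]; rewrite !expeS lee_pmul// expe_ge0.
Qed.

Variables (C : R) (g : T -> R).
Hypothesis hg : tilted_function mu W C g.

Let mg : measurable_fun setT g. Proof. by case: hg. Qed.
Let g0 x : (0 <= g x)%R. Proof. by case: hg. Qed.
Let q := weight W g.
Let q0 z : (0 <= q z)%R. Proof. exact: weight_ge0. Qed.
Let mq : measurable_fun setT q. Proof. exact: measurable_kernel_form. Qed.

Let m_ln : measurable_fun setT (fun x => ln (g x)).
Proof. exact: measurableT_comp. Qed.

Lemma measurable_tilt1 t : measurable_fun setT (tilt1 W g t).
Proof.
apply: measurable_funM => //; apply: measurableT_comp => //.
apply: measurable_funM => //.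
exact: (measurableT_comp m_ln (@measurable_fst _ _ T T)).
Qed.

Lemma measurable_tilt2 t : measurable_fun setT (tilt2 W g t).
Proof.
apply: measurable_funM => //; apply: measurableT_comp => //.
apply: measurable_funM => //.
exact: (measurableT_comp m_ln (@measurable_snd _ _ T T)).
Qed.

Lemma tilt1_ge0 t z : (0 <= tilt1 W g t z)%R.
Proof. by rewrite mulr_ge0// expR_ge0. Qed.

Lemma tilt2_ge0 t z : (0 <= tilt2 W g t z)%R.
Proof. by rewrite mulr_ge0// expR_ge0. Qed.

Let l := (\int[(mu \x mu)%E]_z q z)%R.

Lemma integral_tilt1_le t : (`|t| * C <= 2^-1)%R ->
  \int[mu \x mu]_z (tilt1 W g t z)%:E <= (l * expR (2 * (t * C) ^+ 2))%:E.
Proof.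
case: hg => _ _ gC lnC int0 tC.
apply: (@weighted_mgf_le _ _ _ (mu \x mu : probability _ _) q
  (fun z => ln (g z.1)) (expR C ^+ 2)) => //.
- move=> z; rewrite q0/= /q /weight expr2 ler_pM ?mulr_ge0//.
  by rewrite -[leRHS]mulr1 ler_pM.
- exact: (measurableT_comp m_ln).
Qed.

(** The two marginals of the weight agree because [W] is symmetric. *)
Lemma integral_tilt2E t :
  \int[mu \x mu]_z (tilt2 W g t z)%:E = \int[mu \x mu]_z (tilt1 W g t z)%:E.
Proof.
rewrite ge0_integral_swap; last 2 first.
- by apply/measurable_EFinP; exact: measurable_tilt2.
- by move=> z; rewrite lee_fin tilt2_ge0.
apply: eq_integral => -[x y] _; rewrite /tilt1 /tilt2 /weight/= sW.
by congr (_ * _)%:E; ring.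
Qed.

(** Integrating the pointwise bound [tensor_power_weight_le], the four tilted
    terms use up at most half of the total mass [l ^ k], so the typical set
    carries the other half. *)
Lemma max_density_ge (r t th : R) k :
    (0 <= r)%R -> r%:E * sqnorm mu g < kernel_form mu W g g ->
    (0 <= t)%R -> (t * C <= 2^-1)%R ->
    (8 * (expR (- (t * th)) * expR (2 * (t * C) ^+ 2) ^+ k) <= 1)%R ->
  (r ^+ k * expR (- (4 * th)) / 2)%:E <= max_density mu W k.
Proof.
move=> r0 rl t0 tC small.
have [_ _ gC _ _] := hg.
set P := power_prob mu k.
have lE : kernel_form mu W g g = l%:E.
  rewrite /l /Rintegral fineK//; apply: integrable_fin_num => //.
  apply: (@bounded_integrable _ _ _ (mu \x mu : probability _ _) _
    (expR C ^+ 2)) => // z.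
  rewrite ger0_norm// /q /weight expr2 ler_pM ?mulr_ge0//.
  by rewrite -[leRHS]mulr1 ler_pM.
have N0 : 0 <= sqnorm mu g.
  by apply: integral_ge0 => x _; rewrite lee_fin sqr_ge0.
have l0 : (0 < l)%R.
  by rewrite -lte_fin -lE; apply: le_lt_trans rl; rewrite mule_ge0.
have Nfin : sqnorm mu g \is a fin_num.
  apply: integrable_fin_num => //.
  apply: (@bounded_integrable _ _ _ mu (fun x => g x ^+ 2)%R (expR C ^+ 2)).
    exact: measurable_funX.
  by move=> x; rewrite ger0_norm ?sqr_ge0// lerXn2r// nnegrE ?expR_ge0.
pose N := fine (sqnorm mu g).
have NE : sqnorm mu g = N%:E by rewrite fineK.
have N0' : (0 <= N)%R by rewrite -lee_fin -NE.
have rNl : (r * N <= l)%R by rewrite -lee_fin EFinM -NE -lE ltW.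
pose S : set (k.-tuple T) := typical_set g th.
have mS : measurable S by exact: measurable_typical_set.
have mI : measurable_fun setT (\1_S : _ -> R) by exact: measurable_indic.
have I0 x : (0 <= (\1_S : _ -> R) x)%R by rewrite indicE ler0n.
have I1 x : ((\1_S : _ -> R) x <= 1)%R by rewrite indicE lern1; case: (_ \in _).
pose K (z : k.-tuple T * k.-tuple T) : R :=
  (\1_S z.1 * tensor_power W z * \1_S z.2)%R.
have [mWk _ Wk01] := graphon_tensor_power k hW.
have Wk0 z : (0 <= @tensor_power _ T R W k z)%R by case/andP: (Wk01 z).
have Wk1 z : (@tensor_power _ T R W k z <= 1)%R by case/andP: (Wk01 z).
have mK : measurable_fun setT K.
  apply: measurable_funM; last exact: (measurableT_comp mI).
  by apply: measurable_funM => //; exact: (measurableT_comp mI).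
have K0 z : (0 <= K z)%R by rewrite !mulr_ge0.
have KI z : (K z <= \1_S z.1)%R.
  by rewrite /K -mulrA ler_piMr// mulr_ile1.
have intI1 : \int[P \x P]_z (\1_S z.1)%:E = P S.
  rewrite fubini_tonelli1//; last first.
    by apply/measurable_EFinP; exact: (measurableT_comp mI).
  transitivity (\int[P]_x (\1_S x)%:E); last by rewrite integral_indic ?setIT.
  by apply: eq_integral => x _; rewrite /fubini_F/= integral_prob_cst.
pose I := \int[P \x P]_z (K z)%:E.
have IPS : I <= P S.
  rewrite -intI1; apply: ge0_le_integral_EFin => //.
  exact: (measurableT_comp mI).
have PSfin : P S \is a fin_num by exact: fin_num_measure.
have Ifin : I \is a fin_num.
  rewrite ge0_fin_numE ?(le_lt_trans IPS)//; first by rewrite ltey_eq PSfin.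
  by apply: integral_ge0 => z _; rewrite lee_fin.
pose i := fine I; have iE : I = i%:E by rewrite fineK.
pose p := fine (P S); have pE : P S = p%:E by rewrite fineK.
pose m := expR (2 * (t * C) ^+ 2).
pose mass_le (G : T * T -> R) :=
  [/\ measurable_fun setT (@tensor_power _ T R G k),
    forall z, (0 <= @tensor_power _ T R G k z)%R &
    \int[P \x P]_z (tensor_power G z)%:E <= ((l * m) ^+ k)%:E].
have mass_leP (G : T * T -> R) :
    measurable_fun setT G -> (forall p, 0 <= G p)%R ->
    \int[mu \x mu]_z (G z)%:E <= (l * m)%:E -> mass_le G.
  move=> mG G0 Gle; split; first exact: measurable_tensor_power.
  - by move=> z; exact: tensor_power_ge0.
  - exact: integral_tensor_power_le.
have tC1 : (`|t| * C <= 2^-1)%R by rewrite ger0_norm.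
have tC2 : (`|- t| * C <= 2^-1)%R by rewrite normrN ger0_norm.
have mE : (expR (2 * (- t * C) ^+ 2) = m)%R by rewrite /m mulNr sqrrN.
have [mA1 A10 A1] : mass_le (tilt1 W g t).
  apply: mass_leP; [exact: measurable_tilt1|exact: tilt1_ge0|].
  exact: integral_tilt1_le.
have [mA2 A20 A2] : mass_le (tilt1 W g (- t)).
  apply: mass_leP; [exact: measurable_tilt1|exact: tilt1_ge0|].
  by rewrite -mE; exact: integral_tilt1_le.
have [mA3 A30 A3] : mass_le (tilt2 W g t).
  apply: mass_leP; [exact: measurable_tilt2|exact: tilt2_ge0|].
  by rewrite integral_tilt2E; exact: integral_tilt1_le.
have [mA4 A40 A4] : mass_le (tilt2 W g (- t)).
  apply: mass_leP; [exact: measurable_tilt2|exact: tilt2_ge0|].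
  by rewrite integral_tilt2E -mE; exact: integral_tilt1_le.
(* The tilted terms contribute at most 4 / 8 of the mass, by [small]. *)
have main : (l ^+ k <= expR (2 * th) * i + l ^+ k / 2)%R.
  apply: (@le_trans _ _ (expR (2 * th) * i + expR (- (t * th)) *
    ((l * m) ^+ k + (l * m) ^+ k + ((l * m) ^+ k + (l * m) ^+ k)))%R);
    last first.
    rewrite lerD2l.
    rewrite [leLHS](_ : _ = l ^+ k * (4 * (expR (- (t * th)) * m ^+ k)))%R;
      last by rewrite exprMn; ring.
    rewrite ler_wpM2l ?(exprn_ge0 _ (ltW l0))//; move: small; rewrite -/m.
    set u := (_ * m ^+ k)%R; lra.
  rewrite -lee_fin EFin_expe -lE.
  rewrite (_ : kernel_form mu W g g = \int[mu \x mu]_p (q p)%:E)//.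
  rewrite -ge0_integral_tensor_power// EFinD !EFinM -iE /I.
  apply: (@le_trans _ _ (\int[P \x P]_z (expR (2 * th) * K z +
    expR (- (t * th)) *
    (tensor_power (tilt1 W g t) z + tensor_power (tilt1 W g (- t)) z +
     (tensor_power (tilt2 W g t) z + tensor_power (tilt2 W g (- t)) z)))%:E)).
    apply: ge0_le_integral_EFin.
    - exact: measurable_tensor_power.
    - by move=> z; exact: tensor_power_ge0.
    - by apply: measurable_funD; apply: measurable_funM => //;
        apply: measurable_funD; apply: measurable_funD.
    - by move=> z; exact: tensor_power_weight_le.
  rewrite ge0_integralD_EFin; last 4 first.
  - exact: measurable_funM.
  - by move=> z; rewrite mulr_ge0 ?expR_ge0.
  - by apply: measurable_funM => //; apply: measurable_funD; apply: measurable_funD.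
  - by move=> z; rewrite mulr_ge0 ?expR_ge0 ?addr_ge0.
  rewrite !ge0_integralM_EFin ?expR_ge0//; last 2 first.
  - by apply: measurable_funD; apply: measurable_funD.
  - by move=> z; rewrite !addr_ge0.
  rewrite leeD2l// lee_wpmul2l ?lee_fin ?expR_ge0//.
  exact (ge0_integralD4_le mA1 mA2 mA3 mA4 A10 A20 A30 A40 A1 A2 A3 A4).
(* The second moment of the product function, as a tensor power of a function
   of the first variable only. *)
have PSle : (p <= expR (2 * th) * N ^+ k)%R.
  pose G (z : T * T) := (g z.1 ^+ 2)%R.
  have mG : measurable_fun setT G.
    exact: (measurableT_comp (measurable_funX 2 mg)).
  have G0 z : (0 <= G z)%R by exact: sqr_ge0.
  have GN : \int[mu \x mu]_z (G z)%:E = N%:E.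
    rewrite -NE fubini_tonelli1//; last exact/measurable_EFinP.
    by apply: eq_integral => x _; rewrite /fubini_F /G/= integral_prob_cst.
  rewrite -lee_fin -pE -intI1 EFinM EFin_expe -GN -ge0_integral_tensor_power//.
  rewrite -ge0_integralM_EFin ?expR_ge0//; last 2 first.
  - exact: measurable_tensor_power.
  - by move=> z; exact: tensor_power_ge0.
  apply: ge0_le_integral_EFin => //.
  - exact: (measurableT_comp mI).
  - by apply: measurable_funM => //; exact: measurable_tensor_power.
  - move=> z; rewrite /tensor_power /G prodrXl.
    exact: indic_typical_set_le.
have i_ge : (p * (r ^+ k * expR (- (4 * th)) / 2) <= i)%R.
  apply: (@le_trans _ _ (expR (2 * th) * N ^+ k *
      (r ^+ k * expR (- (4 * th)) / 2))%R).
    by rewrite ler_wpM2r// divr_ge0// mulr_ge0 ?expR_ge0 ?exprn_ge0.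
  have e2 : (expR (2 * th) * expR (- (4 * th)) = expR (- (2 * th)))%R.
    by rewrite -expRD; congr expR; ring.
  rewrite [leLHS](_ : _ = (r * N) ^+ k / 2 * expR (- (2 * th)))%R; last first.
    by rewrite -e2 exprMn; ring.
  apply: (@le_trans _ _ (l ^+ k / 2 * expR (- (2 * th)))%R).
    rewrite ler_wpM2r ?expR_ge0// ler_wpM2r// lerXn2r// nnegrE.
      exact: mulr_ge0.
    exact: ltW.
  by rewrite expRN ler_pdivrMr ?expR_gt0// mulrC; lra.
have i_gt0 : (0 < i)%R.
  have lk0 : (0 < l ^+ k)%R by rewrite exprn_gt0.
  by rewrite -(pmulr_rgt0 _ (expR_gt0 (2 * th))); lra.
have p_gt0 : (0 < p)%R by apply: lt_le_trans i_gt0 _; rewrite -lee_fin -iE -pE.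
apply: (@le_trans _ _ ((P S)^-1 * I)).
  by rewrite pE inver gt_eqF// iE -EFinM lee_fin ler_pdivlMl.
apply: ereal_sup_ubound; exists S => /=.
  by split => //; rewrite -/P pE lte_fin.
by rewrite integral_setX_indic.
Qed.

End density_lower_bound.

(** * Passage to the limit *)

Section density_limit.
Context d (T : measurableType d) (R : realType) (mu : probability T R).
Variable W : T * T -> R.
Hypothesis hW : graphon W.

Lemma near_expr_le_max_density (r : R) : 0 < r -> (r%:E < rho mu W)%E ->
  \forall k \near \oo, ((r ^+ k)%:E <= max_density mu W k)%E.
Proof.
move=> r0; have := rho_ge0 mu W; have := rho_le1 mu hW.
case: (rho mu W) (@exists_tilted_function _ _ _ mu _ hW) => // rr tilted _ _.
rewrite lte_fin => r_rr.
(* The gap between [r] and [rho] is [exp (10 e)]: half of it separates [s] from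
   [rho]; in the other half, [exp (4 e k)] pays for the typical set and
   [exp (e k)] absorbs the factor [2]. *)
pose e := ln (rr / r) / 10.
have rr_r : 1 < rr / r by rewrite ltr_pdivlMr ?mul1r.
have e0 : 0 < e by rewrite divr_gt0// ln_gt0.
pose s := r * expR (5 * e).
have s0 : 0 <= s by rewrite mulr_ge0 ?expR_ge0// ltW.
have s_rr : (s%:E < rr%:E)%E.
  rewrite lte_fin /s mulrC -ltr_pdivlMr//.
  rewrite -[ltRHS]lnK ?posrE ?(lt_trans ltr01)// ltr_expR.
  by move: (e0); rewrite /e; lra.
clearbody e.
have [C [g [C0 hg gs]]] := tilted _ s0 s_rr.
(* With [t = 1 / D] both [t * C <= 1 / 2] and [4 * t * C ^+ 2 <= e] hold; the
   latter makes the second-order term half of the linear gain [t * e]. *)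
pose D := 2 * C + 4 * C ^+ 2 / e + 1.
have Ce0 : 0 <= 4 * C ^+ 2 / e by rewrite divr_ge0 ?(ltW e0)// mulr_ge0 ?sqr_ge0.
have D0 : 0 < D by rewrite /D; lra.
pose t := D^-1; have t0 : 0 < t by rewrite invr_gt0.
have tC : t * C <= 2^-1.
  by rewrite mulrC ler_pdivrMr// /D; lra.
have tC2 : 2 * (t * C) ^+ 2 <= t * e / 2.
  rewrite (_ : 2 * _ = t * (2 * (t * C ^+ 2))); last by ring.
  rewrite -mulrA ler_wpM2l ?(ltW t0)// mulrCA ler_pdivrMl//.
  have : 4 * C ^+ 2 / e <= D by rewrite /D; lra.
  by rewrite ler_pdivrMr// => h; lra.
near=> k.
have k1 : 16 / (t * e) <= k%:R by near: k; exact: nbhs_infty_ger.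
have k2 : e^-1 <= k%:R by near: k; exact: nbhs_infty_ger.
have {}k1 : 8 <= t * e / 2 * k%:R.
  by move: k1; rewrite (ler_pdivrMr _ _ (mulr_gt0 t0 e0)) => h; lra.
have {}k2 : 1 <= e * k%:R by rewrite -ler_pdivrMl// mulr1.
apply: (le_trans _ (@max_density_ge _ _ _ _ _ hW _ _ hg s t (e * k%:R) k
  s0 gs (ltW t0) tC _)).
  rewrite lee_fin /s exprMn -expRM_natr -!mulrA ler_peMr ?exprn_ge0 ?(ltW r0)//.
  rewrite mulrA -expRD (_ : _ + _ = e * k%:R); last by ring.
  have := expR_ge1Dx (e * k%:R); lra.
rewrite -expRM_natr -expRD.
apply: (@le_trans _ _ (8 * expR (- (t * e / 2 * k%:R)))).
  rewrite ler_wpM2l// ler_expR.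
  have := ler_wpM2r (ler0n R k) tC2; lra.
rewrite expRN ler_pdivrMr ?expR_gt0// mul1r.
have := expR_ge1Dx (t * e / 2 * k%:R); lra.
Unshelve. all: by end_near. Qed.

Lemma max_density_ge0 k : (0 <= max_density mu W k)%E.
Proof.
have [_ _ Wk01] := graphon_tensor_power k hW.
have PT : power_prob mu k setT = 1%E by exact: probability_setT.
apply: (@le_trans _ _ ((power_prob mu k setT)^-1 *
    \int[power_prob mu k \x power_prob mu k]_(z in setT `*` setT)
      (tensor_power W z)%:E)%E).
  rewrite PT inve1 mul1e; apply: integral_ge0 => z _.
  by rewrite lee_fin; have /andP[] := Wk01 z.
apply: ereal_sup_ubound; exists setT => //.
by split => //; rewrite PT lte_fin.
Qed.

End density_limit.

Theorem theorem4p1 (R : realType) (d : measure_display) (T : measurableType d)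
    (mu : probability T R) (hmu : standard_atomless mu)
    (W : T * T -> R) (hW : graphon W)
    (W_neq0 : ~ {ae (mu \x mu)%E, forall z, W z = 0}) :
  (fun k : nat => (max_density mu W k `^ (k%:R^-1))%E) @ \oo --> rho mu W.
Proof.
have lower := @near_expr_le_max_density _ _ _ mu _ hW.
have upper k := max_density_le_rho mu hW k.
have := rho_le1 mu hW; have := rho_ge0 mu W.
case: (rho mu W) lower upper => // rr lower upper; rewrite !lee_fin => rr0 rr1.
pose D k := fine (max_density mu W k).
have DE k : max_density mu W k = (D k)%:E.
  rewrite fineK// ge0_fin_numE ?max_density_ge0//.
  by rewrite (le_lt_trans (upper k))// -EFin_expe ltry.
have D0 k : 0 <= D k by rewrite -lee_fin -DE max_density_ge0.
rewrite (_ : (fun k => _) = EFin \o (fun k => D k `^ (k%:R^-1))); last first.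
  by apply/funext => k /=; rewrite DE poweR_EFin.
have root (a : R) k : 0 <= a -> (0 < k)%N -> (a ^+ k) `^ (k%:R^-1) = a.
  move=> a0 k0; rewrite -powR_mulrn// -powRrM mulfV ?powRr1//.
  by rewrite pnatr_eq0 -lt0n.
apply: cvg_EFin; first exact: nearW.
apply/cvgrPdist_le => e e0.
have low : \forall k \near \oo,
    e < rr -> (((rr - e) ^+ k)%:E <= max_density mu W k)%E.
  have [ere|ere] := leP rr e; first exact: nearW.
  apply: filterS (lower (rr - e) _ _) => //; first by rewrite subr_gt0.
  by rewrite lte_fin ltrBlDr ltrDl.
near=> k.
have k0 : (0 < k)%N by near: k; exact: nbhs_infty_gt.
have hi : D k `^ (k%:R^-1) <= rr.
  rewrite -[leRHS](root _ k)//; apply: ge0_ler_powR => //.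
  - by rewrite nnegrE.
  - by rewrite nnegrE exprn_ge0.
  - by rewrite -lee_fin -DE EFin_expe upper.
rewrite ger0_norm ?subr_ge0// lerBlDr -lerBlDl.
have [ere|ere] := leP rr e.
  by rewrite (le_trans _ (powR_ge0 _ _))// subr_le0.
rewrite -[leLHS](root _ k)//; last by rewrite subr_ge0 ltW.
apply: ge0_ler_powR => //; rewrite ?nnegrE//.
  by rewrite exprn_ge0// subr_ge0 ltW.
rewrite -lee_fin -DE; move: ere; near: k; exact: low.
Unshelve. all: by end_near. Qed.
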